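(* Consider a finite MDP that is unichain and uniformly fast mixing, a fixed baseline policy $\pi^*$, and the algorithm EE-Politex run for $T$ steps with exploration policy $\pi_e$, with $n=m=T^{2/5}$, $s'=\log T$, $s=T^{1/5}-s'$ (rounded to integers) and $\eta=\sqrt{8\log(A)/n}/Q_{\max}$. Suppose there are constants $\varepsilon_0\ge 0$, $C>0$, $Q_{\max}>0$ and $b\in\mathbb{R}$ such that for every $\delta\in(0,1)$ and every phase $i\in[n]$, with probability at least $1-\delta$, $$\|Q_{\pi_i}-\widehat Q_i\|_{\nu_{\pi^*}}\le \varepsilon_0+C\sqrt{\log(1/\delta)/m},\qquad \|Q_{\pi_i}-\widehat Q_i\|_{\mu_{\pi^*}\otimes\pi_i}\le \varepsilon_0+C\sqrt{\log(1/\delta)/m},$$ and $\widehat Q_i(x,a)\in[b,b+Q_{\max}]$ for all state-action pairs $(x,a)$. Then for every $\delta\in(0,1)$, with probability at least $1-\delta$, the regret of EE-Politex relative to $\pi^*$ satisfies $$\mathfrak{R}_T=\widetilde O\left(T^{4/5}+\varepsilon_0 T\right).$$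
   Context: MDP: states $[S]$, actions $[A]$, cost $c:[S]\times[A]\to\mathbb{R}$ with $\|c\|_\infty\le 1$, transition kernel $P(x'|x,a)$. A policy $\pi$ maps states to distributions over actions; $P_\pi$ is the induced state transition matrix and $H_\pi((x',a')|(x,a))=P(x'|x,a)\pi(a'|x')$. Unichain: under every policy the states form a single recurrent class. Hence each policy $\pi$ has a unique stationary state distribution $\mu_\pi$; put $\nu_\pi(x,a)=\mu_\pi(x)\pi(a|x)$, and let $\lambda_\pi=\sum_{x,a}\nu_\pi(x,a)c(x,a)$ be its average cost. Uniformly fast mixing: there is a constant $\kappa>0$ such that for every distribution $\mu'$ on states, $\sup_\pi\|(\mu_\pi-\mu')^\top P_\pi\|_1\le \exp(-1/\kappa)\|\mu_\pi-\mu'\|_1$. Action values: $Q_\pi(x,a)$ is the expected total differential cost (cost minus $\lambda_\pi$) when starting in $x$, taking action $a$, and following $\pi$ afterwards; up to an additive constant it is the unique solution of $Q_\pi=c-\lambda_\pi\mathbf{1}+H_\pi Q_\pi$. Norms: for a distribution $\nu$ on $[S]\times[A]$, $\|f\|_\nu=(\sum_{x,a}\nu(x,a)f(x,a)^2)^{1/2}$, and $(\mu\otimes\pi)(x,a)=\mu(x)\pi(a|x)$. EE-Politex (inputs: initial state, exploration policy $\pi_e$, horizon $T$): set $\widehat Q_0\equiv 0$. For each phase $i=1,\dots,n$: let $\pi_i(a|x)\propto\exp(-\eta\sum_{k=0}^{i-1}\widehat Q_k(x,a))$. Then repeat for $j=1,\dots,m$, continuing along the single trajectory of the MDP: execute $\pi_e$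 for $s'$ steps and let $x_j$ be the state reached; take an action $a_j$ drawn uniformly at random and observe the next state $x_j'$; execute $\pi_i$ from $x_j'$ for $s$ steps and record the trajectory $R_j$ of states, actions and costs. Finally compute an estimate $\widehat Q_i$ of $Q_{\pi_i}$ from the data $\{(x_j,a_j,R_j)\}_{j=1}^m$ (by any estimation procedure meeting the stated error hypothesis). Regret: if $(x_t,a_t)$ is the state-action sequence produced by the algorithm and $(x_t^*,a_t^* )$ the sequence produced by following $\pi^*$, then $\mathfrak{R}_T=\sum_{t=1}^T c(x_t,a_t)-\sum_{t=1}^T c(x_t^*,a_t^* )$. $\widetilde O$ hides factors polylogarithmic in $T$ and $1/\delta$ and constants depending on the MDP, $\pi^*$, $\kappa$, $C$, $Q_{\max}$, but not on $T$. *)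

(* Defs.v *)
From HB Require Import structures.
From mathcomp Require Import all_boot all_order all_algebra.
From mathcomp Require Import all_classical all_reals all_analysis.

Set Implicit Arguments.
Unset Strict Implicit.
Unset Printing Implicit Defensive.

Import Order.TTheory GRing.Theory Num.Theory.
Import numFieldNormedType.Exports.

Local Open Scope classical_set_scope.
Local Open Scope ring_scope.

(* Built on MathComp-Analysis.  States are 'I_nS and actions are 'I_nA;
   functions and distributions on state-action pairs, and policies pi(a|x), are
   nS x nA matrices; distributions on states are row vectors. *)

Record mdp (R : realType) (nS nA : nat) := Mdp {
  cost : 'M[R]_(nS, nA);
  trans_prob : 'I_nS -> 'I_nA -> 'I_nS -> R; (* trans_prob x a x' is P(x'|x,a) *)
  cost_bounded : forall x a, `|cost x a| <= 1;
  trans_ge0 : forall x a x', 0 <= trans_prob x a x';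
  trans_sum1 : forall x a, \sum_x' trans_prob x a x' = 1 }.

Definition is_dist (R : realType) (nS : nat) (mu : 'rV[R]_nS) : Prop :=
  (forall x, 0 <= mu 0 x) /\ \sum_x mu 0 x = 1.

Definition is_policy (R : realType) (nS nA : nat) (pi : 'M[R]_(nS, nA)) : Prop :=
  (forall x a, 0 <= pi x a) /\ forall x, \sum_a pi x a = 1.

Definition state_mx (R : realType) (nS nA : nat) (M : mdp R nS nA)
    (pi : 'M[R]_(nS, nA)) : 'M[R]_nS :=
  \matrix_(x, x') \sum_a pi x a * trans_prob M x a x'.

Definition accessible (R : realType) (nS : nat) (Q : 'M[R]_nS) (x y : 'I_nS) : Prop :=
  exists k : nat, 0 < (Q ^+ k) x y.

(* In a finite chain the recurrent classes are exactly the closed communicating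
   classes. *)
Definition recurrent_class (R : realType) (nS : nat) (Q : 'M[R]_nS)
    (C : set 'I_nS) : Prop :=
  [/\ C !=set0,
      forall x y, C x -> accessible Q x y -> C y &
      forall x y, C x -> C y -> accessible Q x y].

Definition unichain (R : realType) (nS nA : nat) (M : mdp R nS nA) : Prop :=
  forall pi, is_policy pi -> recurrent_class (state_mx M pi) setT.

Definition is_stationary (R : realType) (nS nA : nat) (M : mdp R nS nA)
    (pi : 'M[R]_(nS, nA)) (mu : 'rV[R]_nS) : Prop :=
  is_dist mu /\ mu *m state_mx M pi = mu.

(* Unique, hence independent of the choice made by xget, when M is unichain and
   pi is a policy. *)
Definition stat_dist (R : realType) (nS nA : nat) (M : mdp R nS nA)
    (pi : 'M[R]_(nS, nA)) : 'rV[R]_nS :=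
  xget 0 [set mu | is_stationary M pi mu].

Definition otimes (R : realType) (nS nA : nat) (mu : 'rV[R]_nS)
    (pi : 'M[R]_(nS, nA)) : 'M[R]_(nS, nA) :=
  \matrix_(x, a) (mu 0 x * pi x a).

Definition stat_sa_dist (R : realType) (nS nA : nat) (M : mdp R nS nA)
    (pi : 'M[R]_(nS, nA)) : 'M[R]_(nS, nA) :=
  otimes (stat_dist M pi) pi.

Definition avg_cost (R : realType) (nS nA : nat) (M : mdp R nS nA)
    (pi : 'M[R]_(nS, nA)) : R :=
  \sum_x \sum_a stat_sa_dist M pi x a * cost M x a.

Definition norm1 (R : realType) (nS : nat) (v : 'rV[R]_nS) : R :=
  \sum_x `|v 0 x|.

Definition fast_mixing (R : realType) (nS nA : nat) (M : mdp R nS nA)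
    (kappa : R) : Prop :=
  forall (mu' : 'rV[R]_nS) (pi : 'M[R]_(nS, nA)), is_dist mu' -> is_policy pi ->
    norm1 ((stat_dist M pi - mu') *m state_mx M pi)
      <= expR (- (1 / kappa)) * norm1 (stat_dist M pi - mu').

(* H_pi((x',a')|(x,a)) and its action on functions of (x,a). *)
Definition sa_kernel (R : realType) (nS nA : nat) (M : mdp R nS nA)
    (pi : 'M[R]_(nS, nA)) (x : 'I_nS) (a : 'I_nA) (x' : 'I_nS) (a' : 'I_nA) : R :=
  trans_prob M x a x' * pi x' a'.

Definition sa_op (R : realType) (nS nA : nat) (M : mdp R nS nA)
    (pi f : 'M[R]_(nS, nA)) : 'M[R]_(nS, nA) :=
  \matrix_(x, a) \sum_x' \sum_a' sa_kernel M pi x a x' a' * f x' a'.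

(* Entry (x, a) of the t-th iterate is the expected cost after t steps when
   starting in x, taking a and following pi afterwards; the series is the
   expected total differential cost.  It converges under fast mixing, and is the
   solution of Q = c - lambda_pi + H_pi Q normalised by nu_pi Q = 0. *)
Definition action_value (R : realType) (nS nA : nat) (M : mdp R nS nA)
    (pi : 'M[R]_(nS, nA)) : 'M[R]_(nS, nA) :=
  \matrix_(x, a)
    limn (series (fun t : nat =>
      iter t (sa_op M pi) (cost M) x a - avg_cost M pi)).

Definition wnorm (R : realType) (nS nA : nat) (nu f : 'M[R]_(nS, nA)) : R :=
  Num.sqrt (\sum_x \sum_a nu x a * f x a ^+ 2).

Definition softmax (R : realType) (nS nA : nat) (eta : R)
    (G : 'M[R]_(nS, nA)) : 'M[R]_(nS, nA) :=
  \matrix_(x, a) (expR (- eta * G x a) / \sum_a' expR (- eta * G x a')).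

(* A trajectory is a function from time (starting at 0) to state-action pairs,
   of which only a finite initial segment matters. *)
Definition trajectory (nS nA : nat) := nat -> 'I_nS * 'I_nA.

(* The item (x_j, a_j, R_j), with R_j the list of visited (state, action, cost). *)
Definition sample (R : realType) (nS nA : nat) : Type :=
  ('I_nS * 'I_nA * seq ('I_nS * 'I_nA * R))%type.

(* An estimation procedure maps a random seed, a phase index i, the policy pi_i
   and the samples collected in phase i to the estimate of Q_{pi_i}.  The seed
   carries the internal randomness of a randomised procedure. *)
Definition estimator (R : realType) (nS nA : nat) (U : Type) : Type :=
  U -> nat -> 'M[R]_(nS, nA) -> seq (sample R nS nA) -> 'M[R]_(nS, nA).

(* Parameters: number n of phases, m of repetitions per phase, s' of exploration
   steps and s of steps of pi_i per repetition, and the learning rate eta. *)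
Record params (R : realType) := Params {
  n_ : nat; m_ : nat; s'_ : nat; s_ : nat; eta_ : R }.

(* Length of one repetition: s' steps of pi_e, a uniform action, s steps of pi_i. *)
Definition rep_len (R : realType) (p : params R) : nat :=
  (s'_ p + 1 + s_ p)%N.

Definition total_len (R : realType) (p : params R) : nat :=
  (n_ p * (m_ p * rep_len p))%N.

(* Sample j (from 0) of phase i (from 1), read off the trajectory z. *)
Definition get_sample (R : realType) (nS nA : nat) (M : mdp R nS nA)
    (p : params R) (z : trajectory nS nA) (i j : nat) : sample R nS nA :=
  let t0 := ((i.-1 * m_ p + j) * rep_len p + s'_ p)%N in
  ((z t0).1, (z t0).2,
   [seq ((z t).1, (z t).2, cost M (z t).1 (z t).2) | t <- iota t0.+1 (s_ p)]).

Definition phase_data (R : realType) (nS nA : nat) (M : mdp R nS nA)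
    (p : params R) (z : trajectory nS nA) (i : nat) : seq (sample R nS nA) :=
  [seq get_sample M p z i j | j <- iota 0 (m_ p)].

(* est_sum i is Qhat_0 + ... + Qhat_i, with Qhat_0 = 0. *)
Fixpoint est_sum (R : realType) (nS nA : nat) (U : Type) (M : mdp R nS nA)
    (p : params R) (est : estimator R nS nA U) (u : U) (z : trajectory nS nA)
    (i : nat) : 'M[R]_(nS, nA) :=
  if i is k.+1 then
    est_sum M p est u z k
    + est u i (softmax (eta_ p) (est_sum M p est u z k)) (phase_data M p z i)
  else 0.

(* The policy pi_i and the estimate Qhat_i of phase i >= 1. *)
Definition phase_policy (R : realType) (nS nA : nat) (U : Type)
    (M : mdp R nS nA) (p : params R) (est : estimator R nS nA U) (u : U)
    (z : trajectory nS nA) (i : nat) : 'M[R]_(nS, nA) :=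
  softmax (eta_ p) (est_sum M p est u z i.-1).

Definition phase_est (R : realType) (nS nA : nat) (U : Type)
    (M : mdp R nS nA) (p : params R) (est : estimator R nS nA U) (u : U)
    (z : trajectory nS nA) (i : nat) : 'M[R]_(nS, nA) :=
  est u i (phase_policy M p est u z i) (phase_data M p z i).

(* The policy from which the action at time t is drawn; through phase_policy it
   depends on the part of z preceding the current phase only. *)
Definition behaviour (R : realType) (nS nA : nat) (U : Type)
    (M : mdp R nS nA) (p : params R) (pi_e : 'M[R]_(nS, nA))
    (est : estimator R nS nA U) (u : U) (z : trajectory nS nA) (t : nat) :
    'M[R]_(nS, nA) :=
  let r := (t %% rep_len p)%N in
  let i := (t %/ (m_ p * rep_len p)).+1%N in
  if (r < s'_ p)%N then pi_e
  else if r == s'_ p then const_mx (nA%:R^-1)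
  else phase_policy M p est u z i.

(* Probability of the first N state-action pairs of z, when the initial state is
   x0 and the action at time t is drawn from beh t. *)
Definition path_prob (R : realType) (nS nA : nat) (M : mdp R nS nA)
    (x0 : 'I_nS) (beh : nat -> 'M[R]_(nS, nA)) (N : nat)
    (z : trajectory nS nA) : R :=
  ((z 0%N).1 == x0)%:R
  * \prod_(t < N) beh t (z t).1 (z t).2
  * \prod_(t < N.-1) trans_prob M (z t).1 (z t).2 (z t.+1).1.

Definition process_measurable (d : measure_display) (Om : measurableType d)
    (nS nA : nat) (tau : Om -> trajectory nS nA) (N : nat) : Prop :=
  forall (t : nat) (y : 'I_nS * 'I_nA), (t < N)%N ->
    measurable [set w | tau w t = y].

Definition agree_upto (d : measure_display) (Om : measurableType d)
    (nS nA : nat) (tau : Om -> trajectory nS nA) (N : nat)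
    (z : trajectory nS nA) : set Om :=
  [set w | forall t, (t < N)%N -> tau w t = z t].

(* Qhat_i is a random variable, i.e. a measurable function of the seed for each
   realisation of the trajectory. *)
Definition estimator_measurable (R : realType) (nS nA : nat)
    (d : measure_display) (U : measurableType d) (M : mdp R nS nA)
    (p : params R) (est : estimator R nS nA U) : Prop :=
  forall (z : trajectory nS nA) (i : nat) (x : 'I_nS) (a : 'I_nA),
    (1 <= i <= n_ p)%N ->
    measurable_fun [set: U] (fun u : U => phase_est M p est u z i x a).

(* tau is the trajectory of EE-Politex: conditionally on the seed xi, its law is
   the one prescribed by the MDP and the successive behaviour policies. *)
Definition is_eepolitex_run (R : realType) (nS nA : nat) (M : mdp R nS nA)
    (p : params R) (x0 : 'I_nS) (pi_e : 'M[R]_(nS, nA))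
    (dU : measure_display) (U : measurableType dU) (est : estimator R nS nA U)
    (d : measure_display) (Om : measurableType d) (Pr : probability Om R)
    (xi : Om -> U) (tau : Om -> trajectory nS nA) : Prop :=
  [/\ measurable_fun [set: Om] xi,
      process_measurable tau (total_len p) &
      forall (B : set U) (z : trajectory nS nA), measurable B ->
        Pr (xi @^-1` B `&` agree_upto tau (total_len p) z)
        = (\int[Pr]_(w in xi @^-1` B)
            (path_prob M x0 (behaviour M p pi_e est (xi w) z)
               (total_len p) z)%:E)%E].

(* tau is a trajectory of length N obtained by following the policy pi; its joint
   law with other processes on Om is unconstrained. *)
Definition is_policy_run (R : realType) (nS nA : nat) (M : mdp R nS nA)
    (x0 : 'I_nS) (pi : 'M[R]_(nS, nA)) (N : nat)
    (d : measure_display) (Om : measurableType d) (Pr : probability Om R)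
    (tau : Om -> trajectory nS nA) : Prop :=
  process_measurable tau N /\
  forall z : trajectory nS nA,
    Pr (agree_upto tau N z) = (path_prob M x0 (fun=> pi) N z)%:E.

Definition regret (R : realType) (nS nA : nat) (M : mdp R nS nA) (T : nat)
    (z zs : trajectory nS nA) : R :=
  \sum_(t < T) cost M (z t).1 (z t).2 - \sum_(t < T) cost M (zs t).1 (zs t).2.

Definition ceiln (R : realType) (x : R) : nat := `|Num.ceil x|%N.

(* n = m = T^(2/5), s' = log T, s = T^(1/5) - s' (or 0 when this is negative),
   rounded up so that the n phases cover the horizon:
   T <= total_len (eepolitex_params ...). *)
Definition eepolitex_params (R : realType) (nA : nat) (T : nat) (Qmax : R) :
    params R :=
  let n := ceiln ((T%:R : R) `^ (2 / 5)) in
  let s' := ceiln (ln (T%:R : R)) in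
  {| n_ := n;
     m_ := n;
     s'_ := s';
     s_ := (ceiln ((T%:R : R) `^ (1 / 5)) - s')%N;
     eta_ := Num.sqrt (8 * ln nA%:R / n%:R) / Qmax |}.

(* The event that both error bounds (with tolerance e) and the range condition
   hold in phase i. *)
Definition good_estimate (R : realType) (nS nA : nat) (M : mdp R nS nA)
    (pi_star : 'M[R]_(nS, nA)) (b Qmax e : R) (pi_i Qhat_i : 'M[R]_(nS, nA)) : Prop :=
  [/\ wnorm (stat_sa_dist M pi_star) (action_value M pi_i - Qhat_i) <= e,
      wnorm (otimes (stat_dist M pi_star) pi_i) (action_value M pi_i - Qhat_i) <= e &
      forall x a, b <= Qhat_i x a <= b + Qmax].

(* Main.v *)
Require Import Defs.
From HB Require Import structures.
From mathcomp Require Import all_boot all_order all_algebra.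
From mathcomp Require Import all_classical all_reals all_analysis.
From mathcomp Require Import measurable_realfun.
From mathcomp Require Import ring lra.

Set Implicit Arguments.
Unset Strict Implicit.
Unset Printing Implicit Defensive.

Import Order.TTheory GRing.Theory Num.Theory.
Import numFieldNormedType.Exports.

Local Open Scope classical_set_scope.
Local Open Scope ring_scope.

(* The regret splits into the deviation of the costs of the run from the average
   costs of the phase policies, the gap between these average costs and that of
   [pi_star], and the deviation of the baseline run from its average cost.

   Fast mixing bounds all action values by one constant, and Poisson's equation
   [Q = c - lambda + H Q] turns a sum of cost deviations along a stretch on which
   the policy is fixed into a telescoping sum plus martingale differences.  Each
   of the [n * m] repetitions thus costs a constant besides its exploration steps,
   and an exponential-moment bound controls the martingale by [sqrt T].

   By Poisson's equation again, the gap in average cost is a [mu_pi_star]-average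
   of differences of action values.  Replacing these by their estimates costs at
   most twice the estimation error (Cauchy-Schwarz), and exponential weights
   bounds what is left by [O (sqrt n)] phases of length [O (T^(3/5) log T)]. *)

(** The phase policies are random: they depend on the seed and, through an arbitrary estimator, on
    the whole past. No filtration is introduced for this. For a fixed seed the run is a law on
    finitely many paths, exponential moments are finite sums over these paths, and the seed is
    integrated out only once, in Markov's inequality.

    What remains to be checked is measurability in the seed. It is not immediate for [stat_dist] and
    [action_value], the first being defined by choice and the second by a limit; fast mixing
    exhibits both as pointwise limits of explicit iterates.

    Three errors of order [T^(4/5)], up to logarithms, are balanced by the parameters. There are
    about [n * m = T^(4/5)] repetitions, each charged for its [s' + 2] steps outside the reach of
    Poisson's equation; estimation noise contributes [T / sqrt m]; and the regret of exponential
    weights is multiplied by the length of a phase. The martingale terms, of order [sqrt T], are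
    smaller. *)

(* The bound comes from [expR y = expR (y/2) ^+ 2 <= (1 - y/2) ^- 2]. *)
Lemma expR_le_quadratic (R : realType) (y : R) :
  y <= 1 / 3 -> expR y <= 1 + y + y ^+ 2.
Proof.
move=> y3.
have h2 : 0 < 1 - y / 2 by lra.
have e1 : 1 - y / 2 <= expR (- (y / 2)) by have := expR_ge1Dx (- (y / 2)); lra.
have e2 : expR y * expR (- (y / 2)) ^+ 2 = 1.
  rewrite expr2 -!expRD (_ : _ + _ = 0) ?expR0//; lra.
have e3 : expR y * (1 - y / 2) ^+ 2 <= 1.
  rewrite -[leRHS]e2 ler_wpM2l ?expR_ge0//.
  by rewrite lerXn2r ?nnegrE ?expR_ge0// ltW.
have e4 : 1 <= (1 + y + y ^+ 2) * (1 - y / 2) ^+ 2.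
  suff : 0 <= y ^+ 2 * (1 / 4 * (1 - 3 * y) + 1 / 4 * y ^+ 2) by nra.
  by apply: mulr_ge0; [exact: sqr_ge0 | have := sqr_ge0 y; lra].

rewrite -(ler_pM2r (exprn_gt0 2 h2)).
exact: le_trans e4.
Qed.

Lemma cvg_sumr (R : realType) (I : Type) (r : seq I) (f : I -> R^nat) (l : I -> R) :
  (forall i, f i @ \oo --> l i) ->
  (fun n => \sum_(i <- r) f i n) @ \oo --> \sum_(i <- r) l i.
Proof.
by move=> fl; apply: (cvg_big (op := +%R)) => // -[a b]; exact: add_continuous.
Qed.

(** * Poisson's equation and performance differences *)

Section StationaryDistribution.
Variables (R : realType) (nS nA : nat) (M : mdp R nS nA) (kappa : R).
Hypotheses (kappa_gt0 : 0 < kappa) (mixing : fast_mixing M kappa).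

Local Notation rho := (expR (- (1 / kappa))).

Definition step (pi : 'M[R]_(nS, nA)) (v : 'rV[R]_nS) := v *m state_mx M pi.

Definition policy_average (pi f : 'M[R]_(nS, nA)) : 'cV[R]_nS :=
  \col_x \sum_a pi x a * f x a.

Definition next_dist (x : 'I_nS) (a : 'I_nA) : 'rV[R]_nS :=
  \row_x' trans_prob M x a x'.

Lemma rho_lt1 : rho < 1.
Proof. by rewrite expR_lt1 oppr_lt0 divr_gt0. Qed.

Lemma state_mx_ge0 pi x x' : is_policy pi -> 0 <= state_mx M pi x x'.
Proof.
by move=> [pi0 _]; rewrite mxE; apply: sumr_ge0 => a _; rewrite mulr_ge0// trans_ge0.
Qed.

Lemma state_mx_sum1 pi x : is_policy pi -> \sum_x' state_mx M pi x x' = 1.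
Proof.
move=> [_ pi1]; under eq_bigr do rewrite mxE.
rewrite exchange_big /= -(pi1 x); apply: eq_bigr => a _.
by rewrite -mulr_sumr trans_sum1 mulr1.
Qed.

Lemma is_dist_step pi v : is_policy pi -> is_dist v -> is_dist (step pi v).
Proof.
move=> pip [v0 v1]; split=> [x|].
  by rewrite mxE; apply: sumr_ge0 => y _; rewrite mulr_ge0// state_mx_ge0.
under eq_bigr do rewrite mxE.
rewrite exchange_big /= -v1; apply: eq_bigr => y _.
by rewrite -mulr_sumr state_mx_sum1// mulr1.
Qed.

Lemma is_dist_iter_step pi k v :
  is_policy pi -> is_dist v -> is_dist (iter k (step pi) v).
Proof. by move=> pip vd; elim: k => //= k; exact: is_dist_step. Qed.

Lemma is_dist_delta (x : 'I_nS) : is_dist (delta_mx 0 x : 'rV[R]_nS).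
Proof.
split=> [y|]; first by rewrite mxE ler0n.
rewrite (bigD1 x)//= big1 ?addr0 ?mxE ?eqxx// => y yx.
by rewrite mxE (negbTE yx) andbF.
Qed.

Lemma is_dist_next x a : is_dist (next_dist x a).
Proof.
split=> [y|]; first by rewrite mxE trans_ge0.
by rewrite -(trans_sum1 M x a); apply: eq_bigr => y _; rewrite mxE.
Qed.

Lemma norm1_dist (v : 'rV[R]_nS) : is_dist v -> norm1 v = 1.
Proof. by move=> [v0 <-]; apply: eq_bigr => x _; rewrite ger0_norm. Qed.

Lemma norm1_distB (u v : 'rV[R]_nS) : is_dist u -> is_dist v -> norm1 (u - v) <= 2.
Proof.
move=> ud vd; have -> : 2 = norm1 u + norm1 v :> R by rewrite !norm1_dist.
by rewrite -big_split ler_sum// => x _; rewrite !mxE ler_normB.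
Qed.

(* If no stationary distribution existed then [stat_dist] would be the junk value
   [0], and mixing would shrink the mass of a distribution. *)
Lemma stat_distP pi (x0 : 'I_nS) : is_policy pi -> is_stationary M pi (stat_dist M pi).
Proof.
move=> pip; rewrite /stat_dist.
have [[mu mup]|nomu] := pselect (exists mu, is_stationary M pi mu).
  by apply: (xgetPex 0); exists mu.
have st0 : stat_dist M pi = 0.
  by apply: xgetPN => mu mup; apply: nomu; exists mu.
exfalso.
have := mixing (is_dist_delta x0) pip; rewrite st0 sub0r mulNmx.
have normN (v : 'rV[R]_nS) : norm1 (- v) = norm1 v.
  by apply: eq_bigr => x _; rewrite mxE normrN.
rewrite !normN (norm1_dist (is_dist_step pip (is_dist_delta x0))).
rewrite norm1_dist ?mulr1; last exact: is_dist_delta.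
by rewrite leNgt rho_lt1.
Qed.

Lemma step_stat pi (x0 : 'I_nS) : is_policy pi ->
  step pi (stat_dist M pi) = stat_dist M pi.
Proof. by move=> pip; case: (stat_distP x0 pip). Qed.

Lemma norm1_stat_iter pi k v : is_policy pi -> is_dist v ->
  norm1 (stat_dist M pi - iter k (step pi) v) <= 2 * rho ^+ k.
Proof.
move=> pip vd; have [x0 _|nox] := pickP 'I_nS; last first.
  by rewrite /norm1 big1 ?mulr_ge0 ?exprn_ge0 ?expR_ge0// => i; have := nox i.
elim: k => [|k IH].
  rewrite expr0 mulr1 /=; apply: norm1_distB => //.
  by have [] := stat_distP x0 pip.
rewrite iterS -{1}(step_stat x0 pip) /step -mulmxBl.
apply: (le_trans (mixing (is_dist_iter_step k pip vd) pip)).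
rewrite exprS mulrCA ler_wpM2l ?expR_ge0//.
Qed.

(** This replaces a distribution obtained by choice with the limit of polynomials in the entries of
    [pi], which is how its measurability is proved later. *)
Lemma stat_dist_cvg pi x y : is_policy pi ->
  (fun k => iter k (step pi) (delta_mx 0 x) 0 y) @ \oo --> stat_dist M pi 0 y.
Proof.
move=> pip; apply/cvgrPdist_le => e e0.
have : (fun k => 2 * rho ^+ k : R) @ \oo --> 0.
  by apply: cvg_geometric; rewrite ger0_norm ?expR_ge0// rho_lt1.
move/cvgrPdist_le => /(_ e e0); apply: filterS => k.
rewrite sub0r normrN ger0_norm ?mulr_ge0 ?exprn_ge0 ?expR_ge0//; apply: le_trans.
apply: le_trans (norm1_stat_iter k pip (is_dist_delta x)).
rewrite /norm1 (bigD1 y)//= !mxE lerDl sumr_ge0//.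
Qed.

Lemma sa_opE pi f x a :
  sa_op M pi f x a = (next_dist x a *m policy_average pi f) 0 0.
Proof.
rewrite !mxE; apply: eq_bigr => x' _; rewrite !mxE mulr_sumr.
by apply: eq_bigr => a' _; rewrite /sa_kernel mulrA.
Qed.

Lemma policy_average_sa_op pi f :
  policy_average pi (sa_op M pi f) = state_mx M pi *m policy_average pi f.
Proof.
apply/colP => x; rewrite !mxE.
under eq_bigr => a _ do rewrite sa_opE mxE mulr_sumr.
rewrite exchange_big /=; apply: eq_bigr => x' _.
rewrite !mxE mulr_suml; apply: eq_bigr => a _.
by rewrite !mxE mulrA.
Qed.

(** Averaging over actions intertwines [sa_op] with [state_mx], so iterates on functions are traded
    for iterates on state distributions, to which mixing applies. *)
Lemma mulmx_policy_average_iter pi f k v :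
  v *m policy_average pi (iter k (sa_op M pi) f)
  = iter k (step pi) v *m policy_average pi f.
Proof.
elim: k v => [//|k IH] v.
by rewrite iterS policy_average_sa_op mulmxA IH -iterSr.
Qed.

Lemma avg_costE pi :
  avg_cost M pi = (stat_dist M pi *m policy_average pi (cost M)) 0 0.
Proof.
rewrite mxE; apply: eq_bigr => x _; rewrite mxE mulr_sumr.
by apply: eq_bigr => a _; rewrite mxE mulrA.
Qed.

Lemma norm_mulmx_col_le (v : 'rV[R]_nS) (w : 'cV[R]_nS) (D : R) :
  (forall x, `|w x 0| <= D) -> `|(v *m w) 0 0| <= norm1 v * D.
Proof.
move=> wD; rewrite mxE; apply: (le_trans (ler_norm_sum _ _ _)).
rewrite /norm1 mulr_suml; apply: ler_sum => x _.
by rewrite normrM ler_wpM2l.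
Qed.

Lemma policy_average_le pi (f : 'M[R]_(nS, nA)) (D : R) x : is_policy pi ->
  (forall x a, `|f x a| <= D) -> `|policy_average pi f x 0| <= D.
Proof.
move=> [pi0 pi1] fD; rewrite mxE; apply: (le_trans (ler_norm_sum _ _ _)).
rewrite -[leRHS]mul1r -(pi1 x) mulr_suml; apply: ler_sum => a _.
by rewrite normrM ger0_norm// ler_wpM2l.
Qed.

Lemma avg_cost_le1 pi : is_policy pi -> `|avg_cost M pi| <= 1.
Proof.
move=> pip; have [x0 _|nox] := pickP 'I_nS; last first.
  by rewrite /avg_cost big1 ?normr0// => i; have := nox i.
rewrite avg_costE; apply: le_trans (norm_mulmx_col_le _ (D := 1) _) _.
  by move=> x; apply: policy_average_le => // *; exact: cost_bounded.
by rewrite norm1_dist ?mulr1//; have [] := stat_distP x0 pip.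
Qed.

(** The first action is arbitrary, so after [t.+1] steps only [t] contractions are available,
    starting from [next_dist x a]. The division by [rho] makes up for this shift and also covers
    [t = 0], where the trivial bound 2 is used. *)
Lemma differential_cost_le pi t x a : is_policy pi ->
  `|iter t (sa_op M pi) (cost M) x a - avg_cost M pi| <= 2 / rho * rho ^+ t.
Proof.
move=> pip; have rho0 : 0 < rho by exact: expR_gt0.
case: t => [|t].
  rewrite /= expr0 mulr1; apply: (@le_trans _ _ 2).
    apply: (le_trans (ler_normB _ _)); have := cost_bounded M x a.
    by have := avg_cost_le1 pip; lra.
  by rewrite ler_pdivlMr// ler_piMr// ltW// rho_lt1.
rewrite exprS mulrA divfK ?gt_eqF//.
rewrite iterS sa_opE mulmx_policy_average_iter avg_costE.
have -> (u v : 'rV[R]_nS) (w : 'cV[R]_nS) :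
    (u *m w) 0 0 - (v *m w) 0 0 = - ((v - u) *m w) 0 0.
  by rewrite mulmxBl !mxE opprB.
rewrite normrN; apply: le_trans (norm_mulmx_col_le _ (D := 1) _) _.
  by move=> y; apply: policy_average_le => // *; exact: cost_bounded.
by rewrite mulr1; apply: norm1_stat_iter => //; exact: is_dist_next.
Qed.

(** The sum of the geometric series that dominates the differential costs. *)
Definition value_bound : R := 2 / rho / (1 - rho).

Lemma value_bound_gt0 : 0 < value_bound.
Proof. by rewrite !divr_gt0 ?expR_gt0// subr_gt0 rho_lt1. Qed.

Let norm_rho : `|rho| < 1.
Proof. by rewrite ger0_norm ?expR_ge0// rho_lt1. Qed.

Lemma is_cvg_norm_action_value pi x a : is_policy pi ->
  cvgn [normed (series (fun t : nat =>
      iter t (sa_op M pi) (cost M) x a - avg_cost M pi))].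
Proof.
move=> pip; apply: (series_le_cvg (v_ := geometric (2 / rho) rho)) => [t|t|t|].
- exact: normr_ge0.
- by rewrite /geometric /= mulr_ge0 ?exprn_ge0 ?divr_ge0 ?expR_ge0.
- exact: differential_cost_le.
- exact: is_cvg_geometric_series.
Qed.

Lemma action_value_cvg pi x a : is_policy pi ->
  series (fun t : nat => iter t (sa_op M pi) (cost M) x a - avg_cost M pi) @ \oo
    --> action_value M pi x a.
Proof. by move=> pip; rewrite mxE; apply: normed_cvg; exact: is_cvg_norm_action_value. Qed.

Lemma action_value_le pi x a : is_policy pi ->
  `|action_value M pi x a| <= value_bound.
Proof.
move=> pip; rewrite mxE.
apply: (le_trans (lim_series_norm (is_cvg_norm_action_value pip))).
rewrite /value_bound -(cvg_lim _ (cvg_geometric_series (a := 2 / rho) norm_rho))//.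
apply: lim_series_le => [||t]; first exact: is_cvg_norm_action_value.
- exact: is_cvg_geometric_series.
- exact: differential_cost_le.
Qed.

(** The partial sums satisfy the equation up to a shift of the index, because averaging against
    [sa_kernel] preserves constants. Both sides then pass to the limit, the operator being a finite
    sum. *)
Lemma action_value_poisson pi x a : is_policy pi ->
  action_value M pi x a
  = cost M x a - avg_cost M pi + sa_op M pi (action_value M pi) x a.
Proof.
move=> pip.
pose S x a := series (fun t : nat => iter t (sa_op M pi) (cost M) x a - avg_cost M pi).
have cvS y b : S y b @ \oo --> action_value M pi y b by exact: action_value_cvg.
have sum1 (g : R) : \sum_x' \sum_a' sa_kernel M pi x a x' a' * g = g.
  under eq_bigr => x' _ do rewrite -mulr_suml.
  rewrite -mulr_suml -[RHS]mul1r; congr (_ * _).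
  rewrite -[RHS](trans_sum1 M x a); apply: eq_bigr => x' _.
  by rewrite -mulr_sumr (proj2 pip) mulr1.
have rec k : S x a k.+1 = cost M x a - avg_cost M pi
    + \sum_x' \sum_a' sa_kernel M pi x a x' a' * S x' a' k.
  rewrite /S /series /= big_nat_recl//=; congr (_ + _).
  transitivity (\sum_(0 <= t < k) \sum_x' \sum_a' sa_kernel M pi x a x' a' *
     (iter t (sa_op M pi) (cost M) x' a' - avg_cost M pi)).
    apply: eq_bigr => t _; rewrite mxE -{1}(sum1 (avg_cost M pi)) -sumrB.
    by apply: eq_bigr => x' _; rewrite -sumrB; apply: eq_bigr => a' _; rewrite mulrBr.
  rewrite exchange_big /=; apply: eq_bigr => x' _.
  by rewrite exchange_big /=; apply: eq_bigr => a' _; rewrite mulr_sumr.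
have l1 : (fun k => S x a k.+1) @ \oo --> action_value M pi x a.
  by have := cvS x a; rewrite -(cvg_shiftS (S x a)).
have l2 : (fun k => S x a k.+1) @ \oo -->
    cost M x a - avg_cost M pi + sa_op M pi (action_value M pi) x a.
  rewrite (_ : (fun k => _) = (fun k => cost M x a - avg_cost M pi
      + \sum_x' \sum_a' sa_kernel M pi x a x' a' * S x' a' k)); last exact/funext.
  apply: cvgD; first exact: cvg_cst.
  rewrite mxE; apply: cvg_sumr => x'; apply: cvg_sumr => a'.
  by apply: cvgMr; exact: cvS.
by rewrite -(cvg_lim _ l1)// (cvg_lim _ l2).
Qed.

(* Poisson's equation averaged over the stationary distribution of [pi']. *)
Lemma performance_difference pi pi' (x0 : 'I_nS) : is_policy pi -> is_policy pi' ->
  avg_cost M pi - avg_cost M pi'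
  = \sum_x stat_dist M pi' 0 x
      * \sum_a (pi x a - pi' x a) * action_value M pi x a.
Proof.
move=> pip pip'; set Q := action_value M pi; set mu := stat_dist M pi'.
have [[_ mu1] _] := stat_distP x0 pip'.
(* [sa_op M pi] draws the next action from [pi]; preceded by an action of [pi'], it is a step of the
   [pi']-chain followed by an average over [pi]. Stationarity of [mu] absorbs that step. *)
have st : (mu *m policy_average pi Q) 0 0
    = (mu *m policy_average pi' (sa_op M pi Q)) 0 0.
  rewrite /mu -{1}(step_stat x0 pip') /step -mulmxA; congr ((_ *m _) _ _).
  apply/colP => x; rewrite !mxE.
  under [RHS]eq_bigr => a _ do rewrite sa_opE mxE mulr_sumr.
  rewrite exchange_big /=; apply: eq_bigr => y _.
  by rewrite !mxE mulr_suml; apply: eq_bigr => a _; rewrite !mxE mulrA.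
have p : (mu *m policy_average pi' Q) 0 0 = avg_cost M pi' - avg_cost M pi
   + (mu *m policy_average pi' (sa_op M pi Q)) 0 0.
  rewrite (avg_costE pi') -/mu -[X in _ - X]mul1r -mu1 !mxE mulr_suml -sumrB -big_split.
  apply: eq_bigr => x _ /=; rewrite -mulrBr -mulrDr; congr (_ * _); rewrite !mxE.
  rewrite -[X in _ - X]mul1r -(proj2 pip' x) mulr_suml -sumrB -big_split /=.
  apply: eq_bigr => a _; rewrite -mulrBr -mulrDr; congr (_ * _).
  exact: action_value_poisson.
have -> : \sum_x mu 0 x * \sum_a (pi x a - pi' x a) * Q x a
    = (mu *m policy_average pi Q) 0 0 - (mu *m policy_average pi' Q) 0 0.
  rewrite !mxE -sumrB; apply: eq_bigr => x _; rewrite -mulrBr; congr (_ * _).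
  by rewrite !mxE -sumrB; apply: eq_bigr => a _; rewrite mulrBl.
by rewrite p st; ring.
Qed.

End StationaryDistribution.

(** * Exponential weights *)

Section ExponentialWeights.
Variables (R : realType) (nS nA : nat).

Lemma softmax_den_gt0 (eta : R) (G : 'M[R]_(nS, nA)) x : (0 < nA)%N ->
  0 < \sum_a expR (- eta * G x a).
Proof.
move=> nA0; rewrite (bigD1 (Ordinal nA0))//= ltr_pwDl ?expR_gt0//.
by apply: sumr_ge0 => a _; exact: expR_ge0.
Qed.

Lemma softmax_is_policy (eta : R) (G : 'M[R]_(nS, nA)) : (0 < nA)%N ->
  is_policy (softmax eta G).
Proof.
move=> nA0; split=> [x a|x].
  by rewrite mxE divr_ge0 ?expR_ge0// ltW// softmax_den_gt0.
under eq_bigr do rewrite mxE.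
by rewrite -mulr_suml divff// gt_eqF// softmax_den_gt0.
Qed.

Variables (q : nat -> 'M[R]_(nS, nA)) (eta b Qmax : R) (k : nat).
Hypotheses (nA_gt0 : (0 < nA)%N) (eta_gt0 : 0 < eta)
  (q_range : forall i x a, (i < k)%N -> b <= q i x a <= b + Qmax).

Local Notation G i := (\sum_(j < i) q j).
Local Notation p i := (softmax eta (G i)).

Let loss i x := \sum_a p i x a * q i x a.

Let p_policy i : is_policy (p i).
Proof. exact: softmax_is_policy. Qed.

(* Subtracting [b] makes the exponents nonpositive, so that the quadratic upper
   bound on the exponential applies for every [eta]. *)
Lemma exp_weights_step i x : (i < k)%N ->
  \sum_a p i x a * expR (- eta * q i x a)
  <= expR (- eta * loss i x + eta ^+ 2 * Qmax ^+ 2).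
Proof.
move=> ik; have [p0 p1] := p_policy i.
have -> : - eta * loss i x + eta ^+ 2 * Qmax ^+ 2
  = - eta * b + (- eta * (loss i x - b) + eta ^+ 2 * Qmax ^+ 2) by ring.
rewrite expRD; apply: le_trans (ler_wpM2l (expR_ge0 _) (expR_ge1Dx _)).
have -> : expR (- eta * b)
      * (1 + (- eta * (loss i x - b) + eta ^+ 2 * Qmax ^+ 2))
    = \sum_a p i x a * (expR (- eta * b)
        * (1 + (- eta * (q i x a - b)) + eta ^+ 2 * Qmax ^+ 2)).
  transitivity (\sum_a (expR (- eta * b) * (1 + eta * b + eta ^+ 2 * Qmax ^+ 2)
       * p i x a - expR (- eta * b) * eta * (p i x a * q i x a))); last first.
    by apply: eq_bigr => a _; ring.
  rewrite sumrB -!mulr_sumr p1 -/(loss i x); ring.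
apply: ler_sum => a _; apply: ler_wpM2l; first exact: p0.
have -> : - eta * q i x a = - eta * b + - eta * (q i x a - b) by ring.
rewrite expRD ler_wpM2l ?expR_ge0//.
have /andP[qb qB] := q_range x a ik.
have d0 : 0 <= q i x a - b by lra.
have y0 : - eta * (q i x a - b) <= 0 by rewrite mulNr oppr_le0 mulr_ge0// ltW.
apply: le_trans (expR_le_quadratic _) _; first by lra.
rewrite lerD2l exprMn sqrrN ler_wpM2l ?sqr_ge0// lerXn2r ?nnegrE//; lra.
Qed.

(** The potential is the normaliser of [softmax]: each round multiplies it by the mean of
    [expR (- eta * q i x a)] under the current policy, which [exp_weights_step] bounds. *)
Lemma exp_weights_potential i x : (i <= k)%N ->
  \sum_a expR (- eta * G i x a)
  <= nA%:R * expR (\sum_(j < i) (- eta * loss j x + eta ^+ 2 * Qmax ^+ 2)).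
Proof.
elim: i => [|i IH] ik.
  rewrite !big_ord0 expR0 mulr1.
  under eq_bigr do rewrite mxE mulr0 expR0.
  by rewrite sumr_const card_ord.
rewrite [X in expR X]big_ord_recr /= expRD mulrA.
have W0 := softmax_den_gt0 eta (G i) x nA_gt0.
apply: le_trans (ler_wpM2r (expR_ge0 _) (IH (ltnW ik))).
apply: le_trans (ler_wpM2l (ltW W0) (exp_weights_step x ik)).
rewrite mulr_sumr; apply: ler_sum => a _.
rewrite big_ord_recr /= !mxE mulrDr expRD mulrA [X in _ <= X * _]mulrC divfK//.
by rewrite gt_eqF.
Qed.

(** The potential is at least each of its terms. This compares the learner with any single action,
    and averaging over [pi_star] compares it with the mixture. *)
Lemma exp_weights_regret (pi_star : 'M[R]_(nS, nA)) x : is_policy pi_star ->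
  \sum_(i < k) \sum_a (p i x a - pi_star x a) * q i x a
  <= ln nA%:R / eta + eta * k%:R * Qmax ^+ 2.
Proof.
move=> [s0 s1].
have nA0 : 0 < nA%:R :> R by rewrite ltr0n.
have key a : - eta * G k x a
    <= ln nA%:R + \sum_(j < k) (- eta * loss j x + eta ^+ 2 * Qmax ^+ 2).
  rewrite -ler_expR expRD lnK ?posrE//; apply: le_trans (exp_weights_potential x (leqnn k)).
  by rewrite (bigD1 a)//= lerDl sumr_ge0// => c _; rewrite expR_ge0.
have avg : - eta * (\sum_a pi_star x a * G k x a)
    <= ln nA%:R + \sum_(j < k) (- eta * loss j x + eta ^+ 2 * Qmax ^+ 2).
  set L := (X in _ <= X); rewrite -[leRHS]mul1r -(s1 x) mulr_suml mulr_sumr; apply: ler_sum => a _.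
  rewrite mulrCA; apply: ler_wpM2l; [exact: s0|exact: key].
have E : \sum_(i < k) \sum_a (p i x a - pi_star x a) * q i x a
   = \sum_(i < k) loss i x - \sum_a pi_star x a * G k x a.
  under [X in _ = _ - X]eq_bigr => a _ do rewrite summxE mulr_sumr.
  rewrite [X in _ = _ - X]exchange_big -sumrB; apply: eq_bigr => i _; rewrite -sumrB.
  by apply: eq_bigr => a _; rewrite mulrBl.
have e0 : eta != 0 by rewrite gt_eqF.
rewrite E -(ler_pM2l eta_gt0).
have -> : eta * (ln nA%:R / eta + eta * k%:R * Qmax ^+ 2)
    = ln nA%:R + k%:R * (eta ^+ 2 * Qmax ^+ 2) by field.
by move: avg; rewrite big_split /= -mulr_sumr sumr_const card_ord -mulr_natl; lra.
Qed.

End ExponentialWeights.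

(** * Measurability in the policy *)

Section Measurability.
Variables (R : realType) (nS nA : nat) (M : mdp R nS nA) (kappa : R).
Hypotheses (kappa_gt0 : 0 < kappa) (mixing : fast_mixing M kappa).
Variables (dU : measure_display) (U : measurableType dU).

Definition measurable_mx (m n : nat) (f : U -> 'M[R]_(m, n)) : Prop :=
  forall x a, measurable_fun [set: U] (fun u => f u x a).

Lemma measurable_mx_cst m n (A : 'M[R]_(m, n)) : measurable_mx (fun=> A).
Proof. by move=> x a; exact: measurable_cst. Qed.

Lemma measurable_mxD m n (f g : U -> 'M[R]_(m, n)) :
  measurable_mx f -> measurable_mx g -> measurable_mx (fun u => f u + g u).
Proof.
move=> mf mg x a; under eq_fun do rewrite mxE.
by apply: measurable_funD; [exact: mf|exact: mg].
Qed.

Lemma measurable_mxB m n (f g : U -> 'M[R]_(m, n)) :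
  measurable_mx f -> measurable_mx g -> measurable_mx (fun u => f u - g u).
Proof.
move=> mf mg x a; under eq_fun do rewrite !mxE.
by apply: measurable_funB; [exact: mf|exact: mg].
Qed.

Lemma measurable_mulmx m n k (f : U -> 'M[R]_(m, n)) (g : U -> 'M[R]_(n, k)) :
  measurable_mx f -> measurable_mx g -> measurable_mx (fun u => f u *m g u).
Proof.
move=> mf mg x a; under eq_fun do rewrite mxE.
by apply: measurable_sum => y; apply: measurable_funM; [exact: mf|exact: mg].
Qed.

Lemma measurable_state_mx (pi : U -> 'M[R]_(nS, nA)) :
  measurable_mx pi -> measurable_mx (fun u => state_mx M (pi u)).
Proof.
move=> mp x y; under eq_fun do rewrite mxE.
apply: measurable_sum => a; apply: measurable_funM; first exact: mp.
exact: measurable_cst.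
Qed.

Lemma measurable_sa_op (pi f : U -> 'M[R]_(nS, nA)) :
  measurable_mx pi -> measurable_mx f ->
  measurable_mx (fun u => sa_op M (pi u) (f u)).
Proof.
move=> mp mf x a; under eq_fun do rewrite mxE.
apply: measurable_sum => y; apply: measurable_sum => b.
apply: measurable_funM; last exact: mf.
by apply: measurable_funM; [exact: measurable_cst|exact: mp].
Qed.

Lemma measurable_stat_dist (pi : U -> 'M[R]_(nS, nA)) :
  (forall u, is_policy (pi u)) -> measurable_mx pi ->
  measurable_mx (fun u => stat_dist M (pi u)).
Proof.
move=> pip mp i y; rewrite ord1.
apply: (measurable_fun_cvg
  (h := fun k u => iter k (step M (pi u)) (delta_mx 0 y) 0 y)); last first.
  by move=> u _; exact: (stat_dist_cvg kappa_gt0 mixing).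
move=> k; suff H : measurable_mx (fun u => iter k (step M (pi u)) (delta_mx 0 y)).
  exact: H.
elim: k => [|k IH]; first exact: measurable_mx_cst.
by apply: measurable_mulmx => //; exact: measurable_state_mx.
Qed.

Lemma measurable_avg_cost (pi : U -> 'M[R]_(nS, nA)) :
  (forall u, is_policy (pi u)) -> measurable_mx pi ->
  measurable_fun [set: U] (fun u => avg_cost M (pi u)).
Proof.
move=> pip mp; apply: measurable_sum => x; apply: measurable_sum => a.
apply: measurable_funM; last exact: measurable_cst.
under eq_fun do rewrite mxE.
by apply: measurable_funM; [exact: measurable_stat_dist|exact: mp].
Qed.

Lemma measurable_action_value (pi : U -> 'M[R]_(nS, nA)) :
  (forall u, is_policy (pi u)) -> measurable_mx pi ->
  measurable_mx (fun u => action_value M (pi u)).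
Proof.
move=> pip mp x a.
apply: (measurable_fun_cvg (h := fun k u => series (fun t : nat =>
    iter t (sa_op M (pi u)) (cost M) x a - avg_cost M (pi u)) k)); last first.
  by move=> u _; exact: (action_value_cvg kappa_gt0 mixing).
move=> k; rewrite /series /=; apply: measurable_sum => t.
apply: measurable_funB; last exact: measurable_avg_cost.
suff H : measurable_mx (fun u => iter t (sa_op M (pi u)) (cost M)) by exact: H.
by elim: t => [|t IH]; [exact: measurable_mx_cst|exact: measurable_sa_op].
Qed.

Lemma measurable_softmax (eta : R) (G : U -> 'M[R]_(nS, nA)) :
  measurable_mx G -> measurable_mx (fun u => softmax eta (G u)).
Proof.
move=> mG x a; under eq_fun do rewrite mxE.
have mE b : measurable_fun [set: U] (fun u => expR (- eta * G u x b)).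
  apply: measurableT_comp; first exact: measurable_expR.
  by apply: measurable_funM; [exact: measurable_cst|exact: mG].
apply: measurable_funM; first exact: mE.
(* The inverse becomes a real power of exponent [- 1], which is legitimate because the denominator
   is nonnegative. *)
rewrite (_ : (fun u => _) = (fun u => (\sum_c expR (- eta * G u x c)) `^ (- 1))).
  apply: (measurableT_comp (measurable_powR (- 1 : R))
    (g := fun u => \sum_c expR (- eta * G u x c))) => /=.
  by apply: measurable_sum => c; exact: mE.
apply/funext => u; rewrite powR_inv1//.
by apply: sumr_ge0 => c _; exact: expR_ge0.
Qed.

Lemma measurable_wnorm (nu f : U -> 'M[R]_(nS, nA)) :
  measurable_mx nu -> measurable_mx f ->
  measurable_fun [set: U] (fun u => wnorm (nu u) (f u)).
Proof.
move=> mnu mf.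
have ms : measurable_fun [set: R] (@Num.sqrt R).
  by apply: nondecreasing_measurable => //; exact: ler_wsqrtr.
apply: (measurableT_comp ms).
apply: measurable_sum => x; apply: measurable_sum => a.
by apply: measurable_funM; [exact: mnu|apply: measurable_funX; exact: mf].
Qed.

Lemma measurable_good_estimate (pi_star : 'M[R]_(nS, nA)) (b Qmax e : R)
    (pi Qhat : U -> 'M[R]_(nS, nA)) :
  (forall u, is_policy (pi u)) -> measurable_mx pi -> measurable_mx Qhat ->
  measurable [set u | good_estimate M pi_star b Qmax e (pi u) (Qhat u)].
Proof.
move=> pip mp mQ.
have mle (f g : U -> R) : measurable_fun setT f -> measurable_fun setT g ->
    measurable [set u | f u <= g u].
  by move=> mf mg; rewrite -[X in measurable X]setTI; exact: measurable_fun_le.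
have mD : measurable_mx (fun u => action_value M (pi u) - Qhat u).
  by apply: measurable_mxB => //; exact: measurable_action_value.
rewrite (_ : [set u | _] =
    [set u | wnorm (stat_sa_dist M pi_star) (action_value M (pi u) - Qhat u) <= e]
    `&` ([set u | wnorm (otimes (stat_dist M pi_star) (pi u))
                   (action_value M (pi u) - Qhat u) <= e]
    `&` \bigcap_(xa in [set: 'I_nS * 'I_nA])
        ([set u | b <= Qhat u xa.1 xa.2] `&` [set u | Qhat u xa.1 xa.2 <= b + Qmax]))).
  apply: measurableI.
    by apply: mle; [apply: measurable_wnorm => //; exact: measurable_mx_cst|exact: measurable_cst].
  apply: measurableI.
    apply: mle; last exact: measurable_cst.
    apply: measurable_wnorm => // x a; under eq_fun do rewrite mxE.
    by apply: measurable_funM; [exact: measurable_cst|exact: mp].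
  apply: fin_bigcap_measurable => [|xa _]; first exact: finite_finset.
  by apply: measurableI; apply: mle => //; first [exact: measurable_cst|exact: mQ].
apply/seteqP; split=> u /=.
  by move=> [h1 h2 h3]; split=> //; split=> // -[x a] _ /=; have /andP := h3 x a.
move=> [h1 [h2 h3]]; split=> // x a.
by have /= [-> ->] := h3 (x, a) I.
Qed.

End Measurability.

(** * Martingale bounds over finite paths *)

(** Adaptedness is expressed by this relation: what is determined by the first [N] pairs is what is
    invariant under [agree N]. *)
Definition agree (nS nA : nat) (N : nat) (z z' : trajectory nS nA) : Prop :=
  forall t, (t < N)%N -> z t = z' t.

Definition upd (nS nA : nat) (z : trajectory nS nA) (t : nat) (y : 'I_nS * 'I_nA) :
  trajectory nS nA := fun s => if s == t then y else z s.

Lemma upd_eq (nS nA : nat) (z : trajectory nS nA) t y : upd z t y t = y.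
Proof. by rewrite /upd eqxx. Qed.

Lemma upd_lt (nS nA : nat) (z : trajectory nS nA) t y s : (s < t)%N -> upd z t y s = z s.
Proof. by rewrite /upd => st; rewrite ltn_eqF. Qed.

Lemma agree_upd (nS nA : nat) (z : trajectory nS nA) t y : agree t (upd z t y) z.
Proof. by move=> s st; rewrite upd_lt. Qed.

Lemma agreeS (nS nA : nat) N (z z' : trajectory nS nA) : agree N.+1 z z' -> agree N z z'.
Proof. by move=> zz t tN; rewrite zz// ltnW. Qed.

(* The initial segments of length [N], all prolonged by the same [z0]. *)
Fixpoint paths (nS nA : nat) (z0 : trajectory nS nA) (N : nat) :
    seq (trajectory nS nA) :=
  if N is k.+1 then
    [seq upd z k y | z <- paths z0 k, y <- index_enum _]
  else [:: z0].

(** The linear term of the quadratic bound on [expR] averages to zero, which leaves [1 + c ^+ 2]. *)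
Lemma exp_moment_le (R : realType) (I : finType) (w g : I -> R) (s c : R) :
  (forall i, 0 <= w i) -> \sum_i w i = 1 -> 0 <= c <= 1 / 3 ->
  (forall i, `|s * (g i - \sum_j w j * g j)| <= c) ->
  \sum_i w i * expR (s * (g i - \sum_j w j * g j)) <= expR (c ^+ 2).
Proof.
move=> w0 w1 /andP[c0 c3] gc; set m := \sum_j w j * g j.
have m0 : \sum_i w i * (s * (g i - m)) = 0.
  transitivity (s * (\sum_i w i * g i - (\sum_i w i) * m)).
    by rewrite mulr_suml -sumrB mulr_sumr; apply: eq_bigr => i _; ring.
  by rewrite w1 mul1r -/m subrr mulr0.
apply: (@le_trans _ _ (\sum_i (w i * (1 + c ^+ 2) + w i * (s * (g i - m))))).
  apply: ler_sum => i _; rewrite -mulrDr ler_wpM2l//.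
  have gi := gc i; have := ler_norm (s * (g i - m)) => gi'.
  apply: le_trans (expR_le_quadratic _) _; first by rewrite (le_trans gi')// (le_trans gi).
  have : (s * (g i - m)) ^+ 2 <= c ^+ 2.
    by rewrite -[leLHS]real_normK ?num_real// lerXn2r ?nnegrE.
  by rewrite -/m; lra.
by rewrite big_split /= m0 addr0 -mulr_suml w1 mul1r expR_ge1Dx.
Qed.

Section PathSums.
Variables (R : realType) (nS nA : nat) (M : mdp R nS nA) (x0 : 'I_nS)
  (z0 : trajectory nS nA).

Lemma eq_path_prob (beh beh' : nat -> 'M[R]_(nS, nA)) N z z' :
  (forall t, (t < N)%N -> beh t = beh' t) -> agree N z z' -> (0 < N)%N ->
  path_prob M x0 beh N z = path_prob M x0 beh' N z'.
Proof.
move=> bb zz N0; rewrite /path_prob zz//; congr (_ * _ * _).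
  by apply: eq_bigr => t _; rewrite zz// bb.
apply: eq_bigr => t _; have tN := ltn_ord t.
by rewrite !zz//; case: N N0 zz bb t tN => //= N _ _ _ t tN; rewrite ltnW.
Qed.

Lemma path_prob_upd (beh : nat -> 'M[R]_(nS, nA)) N z y :
  path_prob M x0 beh N.+2 (upd z N.+1 y)
  = path_prob M x0 beh N.+1 z
    * (trans_prob M (z N).1 (z N).2 y.1 * beh N.+1 y.1 y.2).
Proof.
rewrite -(@eq_path_prob beh beh N.+1 (upd z N.+1 y) z)//; last exact: agree_upd.
rewrite /path_prob big_ord_recr /= [X in _ * X]big_ord_recr /=.
by rewrite !upd_eq !(upd_lt _ _ (ltnSn N)) upd_lt//; ring.
Qed.

Variable beh : trajectory nS nA -> nat -> 'M[R]_(nS, nA).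
Hypotheses (beh_policy : forall z t, is_policy (beh z t))
  (beh_adapted : forall z z' t, agree t z z' -> beh z t = beh z' t).

Lemma path_prob_ge0 z' N z : 0 <= path_prob M x0 (beh z') N z.
Proof.
rewrite /path_prob !mulr_ge0 ?ler0n// prodr_ge0// => t _.
  by case: (beh_policy z' t).
exact: trans_ge0.
Qed.

(* [G z t] is a multiplicative increment attached to the transition from [t] to
   [t.+1]; a bound on its conditional expectations bounds the expected product. *)
Lemma path_sum_prod_le (G : trajectory nS nA -> nat -> R) (v : nat -> R) N :
  (forall z t, 0 <= G z t) -> (forall t, 0 <= v t) ->
  (forall z z' t, agree t.+2 z z' -> G z t = G z' t) ->
  (forall z t, (t < N)%N ->
     \sum_y (trans_prob M (z t).1 (z t).2 y.1 * beh z t.+1 y.1 y.2)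
            * G (upd z t.+1 y) t <= v t) ->
  \sum_(z <- paths z0 N.+1) path_prob M x0 (beh z) N.+1 z * \prod_(t < N) G z t
  <= \prod_(t < N) v t.
Proof.
move=> G0 v0 Gad; elim: N => [|N IH] Gv.
  rewrite /= big_cat /= big_nil addr0 big_map.
  have E y : path_prob M x0 (beh (upd z0 0 y)) 1 (upd z0 0 y) * \prod_(t < 0) G (upd z0 0 y) t
      = (y.1 == x0)%:R * beh z0 0%N y.1 y.2.
    rewrite /path_prob !big_ord0 big_ord_recl big_ord0 upd_eq !mulr1.
    by rewrite (beh_adapted (z' := z0)).
  rewrite big_ord0; under eq_bigr do rewrite E.
  rewrite -(pair_bigA _ (fun x a => (x == x0)%:R * beh _ 0%N x a)) /=.
  rewrite (bigD1 x0)//= [X in _ + X]big1 => [|x xx0]; last first.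
    by rewrite big1// => a _; rewrite (negbTE xx0) mul0r.
  rewrite addr0 eqxx; under eq_bigr do rewrite mul1r.
  by case: (beh_policy z0 0%N) => _ ->.
rewrite [paths _ _]/= big_allpairs_dep [leRHS]big_ord_recr /=.
apply: le_trans (ler_wpM2r (v0 N) (IH _)); last by move=> z t tN; apply: Gv; rewrite ltnW.
rewrite mulr_suml; apply: ler_sum => z _.
(* By adaptedness the last pair affects neither the policies used before it nor the earlier
   increments, so the weight of a path factors into its past and one transition. *)
apply: (@le_trans _ _ (\sum_y (path_prob M x0 (beh z) N.+1 z * \prod_(t < N) G z t)
   * ((trans_prob M (z N).1 (z N).2 y.1 * beh z N.+1 y.1 y.2) * G (upd z N.+1 y) N))).
  apply: ler_sum => y _; rewrite big_ord_recr /= le_eqVlt; apply/orP; left; apply/eqP.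
  rewrite path_prob_upd (beh_adapted (@agree_upd _ _ z N.+1 y)).
  rewrite (@eq_path_prob (beh (upd z N.+1 y)) (beh z) N.+1 z z)//; last first.
    move=> t tN; apply: beh_adapted => s st; apply: agree_upd; exact: ltn_trans tN.
  have -> : \prod_(t < N) G (upd z N.+1 y) t = \prod_(t < N) G z t.
    apply: eq_bigr => t _; apply: Gad => s st; apply: agree_upd.
    by apply: leq_trans st _; rewrite !ltnS.
  ring.
rewrite -mulr_sumr; apply: ler_wpM2l; last exact: Gv.
by rewrite mulr_ge0 ?path_prob_ge0// prodr_ge0.
Qed.

Variables (f : trajectory nS nA -> nat -> 'M[R]_(nS, nA)) (B : R).
Hypotheses (B_gt0 : 0 < B) (f_le : forall z t x a, `|f z t x a| <= B)
  (f_adapted : forall z z' t, agree t.+1 z z' -> f z t = f z' t).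

(** Given the pairs up to time [t], the next one is drawn from the kernel with policy [beh z t.+1],
    so the subtracted term is a conditional mean. The function [f z t] may itself depend on that
    past, as the action values of the current phase do. *)
Definition mart_diff z t : R :=
  f z t (z t.+1).1 (z t.+1).2 - sa_op M (beh z t.+1) (f z t) (z t).1 (z t).2.

Lemma mart_diff_adapted z z' t : agree t.+2 z z' -> mart_diff z t = mart_diff z' t.
Proof.
move=> zz; rewrite /mart_diff (f_adapted (agreeS zz)) (beh_adapted (agreeS zz)).
by rewrite !zz.
Qed.

(* The scale [1 / (6 B sqrt T)] keeps the exponents below [1/3]. *)
Lemma exp_mart_diff_le T N : (0 < T)%N -> (T <= N.+1)%N ->
  \sum_(z <- paths z0 N.+1) path_prob M x0 (beh z) N.+1 z
     * expR ((6 * B * Num.sqrt T%:R)^-1 * \sum_(t < T.-1) mart_diff z t)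
  <= expR 1.
Proof.
move=> T0 TN; set s := _^-1.
have T0' : 0 < T%:R :> R by rewrite ltr0n.
have sT0 : 0 < Num.sqrt T%:R :> R by rewrite sqrtr_gt0.
have sT1 : 1 <= Num.sqrt T%:R :> R.
  by rewrite -[leLHS]sqrtr1 ler_sqrt ?ler1n.
have s0 : 0 < s by rewrite invr_gt0 !mulr_gt0.
(* An increment is at most [2 * B], hence at most [c] after scaling. The [T.-1] factors
   [expR (c ^+ 2)] multiply to at most [expR (1 / 9)]. *)
pose c := (3 * Num.sqrt T%:R)^-1 : R.
have c0 : 0 < c by rewrite invr_gt0 mulr_gt0.
have sB : s * (2 * B) = c.
  by rewrite /s /c; field; rewrite !gt_eqF.
have c3 : c <= 1 / 3.
  by rewrite /c mul1r lef_pV2 ?posrE ?mulr_gt0//; lra.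
(* Transitions from time [T.-1] on get the factor 1, so a sum stopped at [T] is handled on paths of
   full length. *)
pose G z t := if (t < T.-1)%N then expR (s * mart_diff z t) else 1.
pose v (t : nat) : R := if (t < T.-1)%N then expR (c ^+ 2) else 1.
have prodT (F : nat -> R) :
    \prod_(t < N) (if (t < T.-1)%N then F t else 1) = \prod_(t < T.-1) F t.
  have TN' : (T.-1 <= N)%N by case: (T) T0 TN.
  by rewrite (big_ord_widen N F TN') [RHS]big_mkcond.
have GE z : expR (s * \sum_(t < T.-1) mart_diff z t) = \prod_(t < N) G z t.
  by rewrite mulr_sumr expR_sum -(prodT (fun t => expR (s * mart_diff z t))).
under eq_bigr do rewrite GE.
apply: (le_trans (path_sum_prod_le (v := v) _ _ _ _)).
- by move=> z t; rewrite /G; case: ifP => // _; exact: expR_ge0.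
- by move=> t; rewrite /v; case: ifP => // _; exact: expR_ge0.
- by move=> z z' t zz; rewrite /G (mart_diff_adapted zz).
- move=> z t tN; rewrite /G /v.
  have w1 : \sum_y (trans_prob M (z t).1 (z t).2 y.1 * beh z t.+1 y.1 y.2) = 1.
    rewrite -(pair_bigA _ (fun x a => trans_prob M _ _ x * beh z t.+1 x a)) /=.
    rewrite -[RHS](trans_sum1 M (z t).1 (z t).2); apply: eq_bigr => x _.
    by rewrite -mulr_sumr; case: (beh_policy z t.+1) => _ ->; rewrite mulr1.
  case: ifP => _; last by under eq_bigr do rewrite mulr1; rewrite w1.
  have w0 y : 0 <= trans_prob M (z t).1 (z t).2 y.1 * beh z t.+1 y.1 y.2.
    by rewrite mulr_ge0 ?trans_ge0//; case: (beh_policy z t.+1).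
  have saE : sa_op M (beh z t.+1) (f z t) (z t).1 (z t).2
      = \sum_y (trans_prob M (z t).1 (z t).2 y.1 * beh z t.+1 y.1 y.2) * f z t y.1 y.2.
    by rewrite mxE pair_bigA; apply: eq_bigr => -[].
  have dE y : mart_diff (upd z t.+1 y) t = f z t y.1 y.2
     - \sum_y' (trans_prob M (z t).1 (z t).2 y'.1 * beh z t.+1 y'.1 y'.2)
         * f z t y'.1 y'.2.
    rewrite -saE /mart_diff upd_eq upd_lt//.
    rewrite (beh_adapted (@agree_upd _ _ z t.+1 y)).
    by rewrite (f_adapted (@agree_upd _ _ z t.+1 y)).
  under eq_bigr do rewrite dE.
  apply: (exp_moment_le (g := fun y => f z t y.1 y.2)) => //.
    by rewrite (ltW c0).
  move=> y; rewrite normrM (gtr0_norm s0) -sB ler_wpM2l ?(ltW s0)//.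
  apply: (le_trans (ler_normB _ _)).
  rewrite (_ : 2 * B = B + B) ?lerD//; last by ring.
  apply: (le_trans (ler_norm_sum _ _ _)).
  rewrite -[leRHS]mul1r -w1 mulr_suml; apply: ler_sum => y' _.
  by rewrite normrM (ger0_norm (w0 _)) ler_wpM2l.
rewrite /v (prodT (fun=> expR (c ^+ 2))) prodr_const card_ord -expRM_natl ler_expR.
have -> : c ^+ 2 = (9 * T%:R)^-1.
  rewrite /c exprVn exprMn sqr_sqrtr ?ler0n//; congr (_^-1); ring.
rewrite ler_pdivrMr ?mulr_gt0// mul1r; apply: (@le_trans _ _ T%:R).
  by rewrite ler_nat leq_pred.
by rewrite ler_peMl ?ler0n//; lra.
Qed.

End PathSums.

(** * Tail bounds for processes *)

Section ProcessTails.
Variables (R : realType) (nS nA : nat) (M : mdp R nS nA) (x0 : 'I_nS)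
  (z0 : trajectory nS nA).
Variables (dU : measure_display) (U : measurableType dU)
  (d : measure_display) (Om : measurableType d) (Pr : probability Om R).
Variables (xi : Om -> U) (tau : Om -> trajectory nS nA) (N : nat).
Hypotheses (xi_meas : measurable_fun [set: Om] xi)
  (tau_meas : process_measurable tau N).

Lemma agree_upto_upd k z y :
  agree_upto tau k.+1 (upd z k y) = agree_upto tau k z `&` [set w | tau w k = y].
Proof.
apply/seteqP; split=> w /=.
  move=> zz; split=> [t tk|]; last by rewrite zz// upd_eq.
  by rewrite zz ?upd_lt// ltnW.
move=> [zz zk] t; rewrite ltnS leq_eqVlt => /orP[/eqP ->|tk]; first by rewrite upd_eq.
by rewrite zz// upd_lt.
Qed.

Lemma agree_upto_bigcup k z :
  agree_upto tau k z = \bigcup_(y in [set: 'I_nS * 'I_nA]) agree_upto tau k.+1 (upd z k y).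
Proof.
apply/seteqP; split=> w.
  by move=> zz; exists (tau w k) => //; rewrite agree_upto_upd.
by move=> [y _]; rewrite agree_upto_upd => -[].
Qed.

(** Only the coordinates before [N] are known to be measurable. An event is therefore cut along the
    finitely many initial segments and reassembled one coordinate at a time. *)
Lemma measurable_of_paths (E : set Om) :
  (forall z, measurable (E `&` agree_upto tau N z)) -> measurable E.
Proof.
elim: N => [|k IH] mE.
  have := mE z0; rewrite (_ : agree_upto tau 0 z0 = setT) ?setIT//.
  by apply/seteqP; split.
apply: IH => z; rewrite agree_upto_bigcup setI_bigcupr.
by apply: fin_bigcup_measurable => // *; exact: finite_finset.
Qed.

Lemma measurable_agree_upto k z : (k <= N)%N -> measurable (agree_upto tau k z).
Proof.
elim: k z => [|k IH] z kN.
  by rewrite (_ : agree_upto _ _ _ = setT)//; apply/seteqP; split.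
have -> : agree_upto tau k.+1 z = agree_upto tau k z `&` [set w | tau w k = z k].
  apply/seteqP; split=> w /=; first by move=> zz; split=> [t tk|]; rewrite zz// ltnW.
  by move=> [zz zk] t; rewrite ltnS leq_eqVlt => /orP[/eqP ->//|]; exact: zz.
by apply: measurableI; [exact: IH (ltnW kN)|exact: tau_meas].
Qed.

Lemma prob_le_sum_paths (E : set Om) : measurable E ->
  (Pr E <= \sum_(z <- paths z0 N) Pr (E `&` agree_upto tau N z))%E.
Proof.
move=> mE; suff H k : (k <= N)%N ->
    (Pr E <= \sum_(z <- paths z0 k) Pr (E `&` agree_upto tau k z))%E by exact: H.
elim: k => [|k IH] kN.
  by rewrite /= big_seq1 (_ : agree_upto _ _ _ = setT) ?setIT//; apply/seteqP; split.
apply: (le_trans (IH (ltnW kN))); rewrite [paths _ _]/= big_allpairs_dep.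
apply: lee_sum => z _.
have mI y : measurable (E `&` agree_upto tau k.+1 (upd z k y)).
  by apply: measurableI => //; exact: measurable_agree_upto.
rewrite (_ : _ `&` _ = \big[setU/set0]_(y <- index_enum _)
    (E `&` agree_upto tau k.+1 (upd z k y))); last first.
  rewrite agree_upto_bigcup setI_bigcupr -bigcup_seq.
  by apply/seteqP; split=> w [y _ Fy]; exists y => //=; rewrite mem_index_enum.
elim: (index_enum _) => [|y s IHs]; first by rewrite !big_nil measure0.
rewrite !big_cons; apply: (le_trans (measureU2 _ _ _)) => //.
  by apply: bigsetU_measurable => i _.
exact: leeD2l.
Qed.

(** On one initial segment [tau] may be replaced by a fixed [z], so only a condition on the seed is
    left. *)
Lemma measurable_process_set (Q : U -> trajectory nS nA -> Prop) :
  (forall z, measurable [set u | Q u z]) ->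
  (forall u z z', agree N z z' -> Q u z -> Q u z') ->
  measurable [set w | Q (xi w) (tau w)].
Proof.
move=> mQ Qad; apply: measurable_of_paths => z.
rewrite (_ : _ `&` _ = (xi @^-1` [set u | Q u z]) `&` agree_upto tau N z); last first.
  apply/seteqP; split=> w /= [Qw zz]; split=> //; first exact: Qad Qw.
  by apply: Qad Qw => t tN; rewrite zz.
apply: measurableI; last exact: measurable_agree_upto.
by rewrite -[X in measurable X]setTI; exact: xi_meas.
Qed.

Variable beh : U -> trajectory nS nA -> nat -> 'M[R]_(nS, nA).
Hypotheses (N_gt0 : (0 < N)%N)
  (beh_policy : forall u z t, is_policy (beh u z t))
  (beh_adapted : forall u z z' t, agree t z z' -> beh u z t = beh u z' t)
  (beh_meas : forall z t, (t < N)%N -> measurable_mx (fun u => beh u z t))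
  (law : forall (B : set U) z, measurable B ->
     Pr (xi @^-1` B `&` agree_upto tau N z)
     = (\int[Pr]_(w in xi @^-1` B) (path_prob M x0 (beh (xi w) z) N z)%:E)%E).

Lemma measurable_path_prob z :
  measurable_fun [set: U] (fun u => path_prob M x0 (beh u z) N z).
Proof.
apply: measurable_funM; last exact: measurable_cst.
apply: measurable_funM; first exact: measurable_cst.
by apply: measurable_prod => t _; apply: beh_meas.
Qed.

(** Markov's inequality, with the expectation computed seed by seed. On each initial segment the
    event concerns the seed alone, so [law] gives its probability and [g / a] dominates the
    indicator. Exchanging the sum over paths with the integral brings in the bound [K]. *)
Lemma process_markov (g : U -> trajectory nS nA -> R) (a K : R) :
  0 < a -> (forall u z, 0 <= g u z) ->
  (forall z, measurable_fun [set: U] (g^~ z)) ->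
  (forall u z z', agree N z z' -> g u z = g u z') ->
  (forall u, \sum_(z <- paths z0 N) path_prob M x0 (beh u z) N z * g u z <= K) ->
  measurable [set w | a <= g (xi w) (tau w)] /\
  (Pr [set w | (a <= g (xi w) (tau w))%R] <= (K / a)%:E)%E.
Proof.
move=> a0 g0 mg gad gK.
have mB z : measurable [set u | a <= g u z].
  rewrite -[X in measurable X]setTI; apply: measurable_fun_le => //; exact: measurable_cst.
have mE : measurable [set w | a <= g (xi w) (tau w)].
  apply: (measurable_process_set (Q := fun u z => a <= g u z)) => // u z z' zz.
  by rewrite (gad u z z').
split=> //.
pose h z w := (path_prob M x0 (beh (xi w) z) N z * (g (xi w) z / a))%:E.
have pp0 u z z' : 0 <= path_prob M x0 (beh u z) N z' by apply: path_prob_ge0.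
have mh z : measurable_fun [set: Om] (h z).
  apply/measurable_EFinP.
  apply: (measurableT_comp (f := fun u => path_prob M x0 (beh u z) N z * (g u z / a))) => //.
  apply: measurable_funM; first exact: measurable_path_prob.
  by apply: measurable_funM; [exact: mg|exact: measurable_cst].
have h0 z w : (0 <= h z w)%E by rewrite lee_fin mulr_ge0// divr_ge0// ltW.
apply: (le_trans (prob_le_sum_paths mE)).
apply: (@le_trans _ _ (\sum_(z <- paths z0 N) \int[Pr]_w h z w)%E).
  apply: lee_sum => z _.
  rewrite (_ : _ `&` _ = (xi @^-1` [set u | a <= g u z]) `&` agree_upto tau N z); last first.
    apply/seteqP; split=> w /= [gw zz]; split=> //.
      by rewrite -(gad _ (tau w)).
    by rewrite (gad _ _ z).
  have mX : measurable (xi @^-1` [set u | a <= g u z]).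
    by rewrite -[X in measurable X]setTI; exact: xi_meas.
  rewrite law//; apply: (@le_trans _ _ (\int[Pr]_(w in xi @^-1` [set u | (a <= g u z)%R]) h z w)%E).
    apply: ge0_le_integral => //.
    - by move=> w _; rewrite lee_fin.
    - apply: (measurable_funS measurableT) => //; apply/measurable_EFinP.
      by apply: (measurableT_comp (measurable_path_prob z)).
    - exact: (measurable_funS measurableT).
    - move=> w /= aw; rewrite lee_fin ler_peMr//.
      by rewrite ler_pdivlMr// mul1r.
  by apply: ge0_subset_integral.
rewrite -ge0_integral_sum//.
apply: (@le_trans _ _ (\int[Pr]_w (cst (K / a)%:E w))%E); last first.
  rewrite integral_cst// [X in (_ * X <= _)%E](_ : _ = 1%E) ?mule1//.
  exact: probability_setT.
apply: ge0_le_integral => //.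
- by move=> w _; apply: sume_ge0.
- exact: emeasurable_sum.
- move=> w _; rewrite /h sumEFin lee_fin /=.
  under eq_bigr do rewrite mulrA.
  by rewrite -mulr_suml ler_wpM2r// invr_ge0 ltW.
Qed.

Variables (f : U -> trajectory nS nA -> nat -> 'M[R]_(nS, nA)) (B : R).
Hypotheses (B_gt0 : 0 < B) (f_le : forall u z t x a, `|f u z t x a| <= B)
  (f_adapted : forall u z z' t, agree t.+1 z z' -> f u z t = f u z' t)
  (f_meas : forall z t, (t.+1 < N)%N -> measurable_mx (fun u => f u z t)).

(** The result is an exceptional set, ready for a union bound. It controls one side only; the other
    side is reached by negating [f]. *)
Lemma azuma T (delta : R) : (0 < T <= N)%N -> 0 < delta ->
  exists A : set Om, [/\ measurable A, (Pr A <= delta%:E)%E &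
    forall w, ~ A w ->
      \sum_(t < T.-1) mart_diff M (beh (xi w)) (f (xi w)) (tau w) t
      <= 6 * B * Num.sqrt T%:R * (1 + ln (1 / delta))].
Proof.
move=> /andP[T0 TN] d0.
pose S u z := \sum_(t < T.-1) mart_diff M (beh u) (f u) z t.
pose s := (6 * B * Num.sqrt T%:R)^-1.
have T0' : 0 < T%:R :> R by rewrite ltr0n.
have s0 : 0 < s by rewrite invr_gt0 !mulr_gt0// sqrtr_gt0.
(* The summand 1 cancels the bound [expR 1] on the exponential moment, which leaves exactly
   [delta]. *)
pose L := 1 + ln (1 / delta).
have tT (t : 'I_T.-1) : (t.+1 < N)%N.
  by apply: leq_trans TN; case: (T) T0 t => // T' _ [t].
have mS z : measurable_fun [set: U] (S^~ z).
  apply: measurable_sum => t; apply: measurable_funB; first exact: f_meas.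
  by apply: measurable_sa_op; [exact: beh_meas|exact: f_meas].
have Sad u z z' : agree N z z' -> S u z = S u z'.
  move=> zz; apply: eq_bigr => t _; apply: mart_diff_adapted;
    [exact: beh_adapted|exact: f_adapted|].
  by move=> r rt; apply: zz; exact: leq_trans rt (tT t).
have expS u : \sum_(z <- paths z0 N) path_prob M x0 (beh u z) N z * expR (s * S u z)
    <= expR 1.
  rewrite -(prednK N_gt0).
  apply: exp_mart_diff_le; rewrite ?prednK//;
    first [exact: beh_adapted|exact: f_adapted].
have [mE PE] := @process_markov (fun u z => expR (s * S u z)) (expR L) (expR 1)
  (expR_gt0 _) (fun _ _ => expR_ge0 _)
  (fun z => measurableT_comp (@measurable_expR R)
     (measurable_funM (measurable_cst s) (mS z)))
  (fun u z z' zz => congr1 (fun x => expR (s * x)) (Sad u z z' zz)) expS.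
exists [set w | expR L <= expR (s * S (xi w) (tau w))]; split=> //.
  apply: (le_trans PE); rewrite lee_fin -expRN -expRD /L opprD addrA subrr add0r -lnV ?posrE ?divr_gt0//.
  by rewrite div1r invrK lnK.
move=> w /= /negP; rewrite ler_expR -ltNge => /ltW.
by rewrite /s mulrC ler_pdivrMr 1?mulrC// !mulr_gt0// sqrtr_gt0.
Qed.

End ProcessTails.

(** * Finite sums, weighted means and the baseline run *)

Lemma sum_ord_mul (R : nmodType) (F : nat -> R) k r :
  \sum_(t < k * r) F t = \sum_(i < k) \sum_(j < r) F (i * r + j)%N.
Proof.
elim: k => [|k IH]; first by rewrite mul0n !big_ord0.
by rewrite big_ord_recr /= mulSnr big_split_ord /= IH.
Qed.

Lemma ler_sum_ord_widen (R : realDomainType) (F : nat -> R) m n :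
  (m <= n)%N -> (forall i, 0 <= F i) -> \sum_(i < m) F i <= \sum_(i < n) F i.
Proof.
move=> mn F0; rewrite -(subnKC mn) big_split_ord /= lerDl.
exact: sumr_ge0.
Qed.

(** The variance of [f] under [nu] is nonnegative. *)
Lemma mean_le_wnorm (R : realType) (nS nA : nat) (nu f : 'M[R]_(nS, nA)) :
  (forall x a, 0 <= nu x a) -> \sum_x \sum_a nu x a = 1 ->
  `|\sum_x \sum_a nu x a * f x a| <= wnorm nu f.
Proof.
move=> nu0 nu1; set mean := \sum_x \sum_a nu x a * f x a.
rewrite -sqrtr_sqr /wnorm ler_wsqrtr// -subr_ge0.
have e2 : 2 * mean * mean = \sum_x \sum_a 2 * mean * (nu x a * f x a).
  by rewrite [LHS]mulr_sumr; apply: eq_bigr => x _; exact: mulr_sumr.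
clearbody mean; set S := (X in X - _).
have -> : S - mean ^+ 2 = \sum_x \sum_a nu x a * (f x a - mean) ^+ 2.
  transitivity (S - 2 * mean * mean + mean ^+ 2 * \sum_x \sum_a nu x a).
    by rewrite nu1; ring.
  rewrite e2 /S mulr_sumr -sumrB -big_split; apply: eq_bigr => x _ /=.
  by rewrite mulr_sumr -sumrB -big_split; apply: eq_bigr => a _ /=; ring.
by apply: sumr_ge0 => x _; apply: sumr_ge0 => a _; rewrite mulr_ge0// sqr_ge0.
Qed.

Lemma sa_opN (R : realType) (nS nA : nat) (M : mdp R nS nA) (pi f : 'M[R]_(nS, nA)) :
  sa_op M pi (- f) = - sa_op M pi f.
Proof.
apply/matrixP => x a; rewrite !mxE -sumrN; apply: eq_bigr => y _.
by rewrite -sumrN; apply: eq_bigr => b _; rewrite !mxE mulrN.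
Qed.

Section PolicyRun.
Variables (R : realType) (nS nA : nat) (M : mdp R nS nA) (kappa : R).
Hypotheses (kappa_gt0 : 0 < kappa) (mixing : fast_mixing M kappa).

Local Notation B := (value_bound kappa).

(** Regret suffers when the baseline run is cheaper than its average, so the tail bound is applied
    to [- Q]. A fixed policy involves no randomness of an estimator, and the seed is taken in
    [unit]. *)
Lemma policy_run_lower_bound (x0 : 'I_nS) (pi : 'M[R]_(nS, nA)) (T : nat)
    (d : measure_display) (Om : measurableType d) (Pr : probability Om R)
    (tau : Om -> trajectory nS nA) (delta : R) :
  is_policy pi -> (0 < nA)%N -> (0 < T)%N -> is_policy_run M x0 pi T Pr tau -> 0 < delta ->
  exists A : set Om, [/\ measurable A, (Pr A <= delta%:E)%E &
    forall w, ~ A w ->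
      \sum_(t < T) (avg_cost M pi - cost M (tau w t).1 (tau w t).2)
      <= 2 * B + 2 + 6 * B * Num.sqrt T%:R * (1 + ln (1 / delta))].
Proof.
move=> pip nA0 T0 [mtau law] d0.
pose z0 : trajectory nS nA := fun=> (x0, Ordinal nA0).
pose Q := action_value M pi.
have B0 : 0 < B by exact: value_bound_gt0.
have QB x a : `|Q x a| <= B by exact: action_value_le.
have lawU (D : set unit) z : measurable D ->
    Pr ((fun=> tt) @^-1` D `&` agree_upto tau T z)
    = (\int[Pr]_(w in (fun=> tt) @^-1` D) (path_prob M x0 (fun=> pi) T z)%:E)%E.
  move=> _; have [Dt|nDt] := pselect (D tt).
    rewrite (_ : _ @^-1` D = setT); last by apply/seteqP; split.
    rewrite setTI law (integral_cst Pr measurableT) [X in (_ * X)%E](_ : _ = 1%E) ?mule1//.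
    exact: probability_setT.
  rewrite (_ : _ @^-1` D = set0); last by apply/seteqP; split.
  by rewrite set0I measure0 integral_set0.
have [A [mA PA A_le]] := @azuma R nS nA M x0 z0 _ unit _ Om Pr (fun=> tt) tau T
  (measurable_cst tt) mtau (fun _ _ _ => pi) T0 (fun _ _ _ => pip)
  (fun _ _ _ _ _ => erefl) (fun _ _ _ => measurable_mx_cst pi) lawU
  (fun _ _ _ => - Q) B B0 (fun _ _ _ x a => ltac:(by rewrite mxE normrN))
  (fun _ _ _ _ _ => erefl) (fun _ _ _ => measurable_mx_cst _)
  T delta (introT andP (conj T0 (leqnn T))) d0.
exists A; split=> // w /A_le; move: (tau w) => z {A mA PA A_le}.
pose D t := mart_diff M (fun _ _ => pi) (fun _ _ => - Q) z t.
have DE t : D t = sa_op M pi Q (z t).1 (z t).2 - Q (z t.+1).1 (z t.+1).2.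
  by rewrite /D /mart_diff sa_opN !mxE opprK addrC.
have poisson x a : avg_cost M pi - cost M x a = sa_op M pi Q x a - Q x a.
  by rewrite /Q [in X in _ = _ - X](action_value_poisson kappa_gt0 mixing)//; ring.
have tele N : \sum_(t < N.+1) (avg_cost M pi - cost M (z t).1 (z t).2)
   = \sum_(t < N) D t + (sa_op M pi Q (z N).1 (z N).2 - Q (z 0%N).1 (z 0%N).2).
  elim: N => [|N IH]; first by rewrite big_ord_recl !big_ord0 addr0 add0r poisson.
  by rewrite big_ord_recr IH [in RHS]big_ord_recr /= poisson DE; ring.
move=> D_le; have := tele T.-1; rewrite (prednK T0) => ->.
have {}D_le : \sum_(t < T.-1) D t
    <= 6 * B * Num.sqrt T%:R * (1 + ln (1 / delta)) by exact: D_le.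
(* The boundary term [sa_op M pi Q] at the last pair is rewritten by Poisson's equation as a cost
   gap, at most 2, plus a value, at most [B]; the initial value adds another [B]. *)
have := QB (z T.-1).1 (z T.-1).2; have := QB (z 0%N).1 (z 0%N).2.
have := poisson (z T.-1).1 (z T.-1).2.
have := cost_bounded M (z T.-1).1 (z T.-1).2; have := avg_cost_le1 kappa_gt0 mixing pip.
rewrite !ler_norml => /andP[? ?] /andP[? ?] ? /andP[? ?] /andP[? ?].
lra.
Qed.

End PolicyRun.

(** * Structure of the algorithm *)

Section AlgorithmStructure.
Variables (R : realType) (nS nA : nat) (M : mdp R nS nA) (p : params R)
  (pi_e : 'M[R]_(nS, nA)) (U : Type) (est : estimator R nS nA U).
Hypotheses (nA_gt0 : (0 < nA)%N) (pi_e_policy : is_policy pi_e).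

Local Notation L := (m_ p * rep_len p)%N.

Lemma rep_len_gt0 : (0 < rep_len p)%N.
Proof. by rewrite /rep_len addn1. Qed.

Lemma phase_data_adapted z z' i :
  (0 < i)%N -> agree (i * L) z z' -> phase_data M p z i = phase_data M p z' i.
Proof.
case: i => // i _ zz; apply/eq_in_map => j; rewrite mem_iota add0n => /andP[_ jm].
have lt_end r : (r < rep_len p)%N -> ((i * m_ p + j) * rep_len p + r < i.+1 * L)%N.
  move=> rr; apply: (@leq_trans ((i * m_ p + j).+1 * rep_len p)).
    by rewrite mulSn addnC ltn_add2r.
  rewrite mulnA leq_mul2r; apply/orP; right.
  by rewrite mulSn -addnS [leqRHS]addnC leq_add2l.
have s'r : (s'_ p < rep_len p)%N by rewrite /rep_len addn1 addSn ltnS leq_addr.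
rewrite /get_sample /= zz; last exact: lt_end.
congr (_, _); apply/eq_in_map => t; rewrite mem_iota => /andP[_ tl].
rewrite zz//; apply: leq_trans tl _; rewrite addSn -addnA; apply: lt_end.
by rewrite /rep_len addn1 addSn ltnS.
Qed.

Lemma est_sum_adapted u z z' i :
  agree (i * L) z z' -> est_sum M p est u z i = est_sum M p est u z' i.
Proof.
elim: i => //= i IH zz; rewrite (phase_data_adapted _ zz)// IH// => t ti.
by apply: zz; apply: leq_trans ti _; rewrite mulSn leq_addl.
Qed.

(** Phases are numbered from 1 and times from 0: phase [i.+1] starts at time [i * L], and its policy
    is already determined then. *)
Lemma phase_policy_adapted u z z' i :
  agree (i * L) z z' -> phase_policy M p est u z i.+1 = phase_policy M p est u z' i.+1.
Proof. by move=> zz; rewrite /phase_policy (est_sum_adapted _ zz). Qed.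

Lemma phase_est_adapted u z z' i :
  agree (i.+1 * L) z z' -> phase_est M p est u z i.+1 = phase_est M p est u z' i.+1.
Proof.
move=> zz; rewrite /phase_est (phase_data_adapted _ zz)// (@phase_policy_adapted _ _ z')//.
by move=> t ti; apply: zz; apply: leq_trans ti _; rewrite mulSn leq_addl.
Qed.

Lemma est_sumE u z k : est_sum M p est u z k = \sum_(j < k) phase_est M p est u z j.+1.
Proof. by elim: k => [|k IH]; rewrite ?big_ord0// big_ord_recr /= -IH. Qed.

Lemma phase_policy_is_policy u z i : is_policy (phase_policy M p est u z i).
Proof. exact: softmax_is_policy. Qed.

Lemma uniform_is_policy : is_policy (const_mx (nA%:R^-1) : 'M[R]_(nS, nA)).
Proof.
split=> [x a|x]; first by rewrite mxE invr_ge0 ler0n.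
under eq_bigr do rewrite mxE.
by rewrite sumr_const card_ord -[LHS]mulr_natl divff// pnatr_eq0 -lt0n.
Qed.

Lemma behaviour_is_policy u z t : is_policy (behaviour M p pi_e est u z t).
Proof.
rewrite /behaviour; case: ifP => // _; case: ifP => _; first exact: uniform_is_policy.
exact: phase_policy_is_policy.
Qed.

Lemma behaviour_adapted u z z' t : agree t z z' ->
  behaviour M p pi_e est u z t = behaviour M p pi_e est u z' t.
Proof.
move=> zz; rewrite /behaviour; case: ifP => // _; case: ifP => // _.
apply: phase_policy_adapted => r rt; apply: zz; apply: leq_trans rt _.
exact: leq_divM.
Qed.

(* Steps after which the current repetition continues with the phase policy. *)
Definition rollout_step (t : nat) : bool :=
  (s'_ p < t %% rep_len p)%N && ((t %% rep_len p).+1 < rep_len p)%N.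

Lemma rollout_phase t : rollout_step t -> (t.+1 %/ L = t %/ L)%N.
Proof.
move=> /andP[_ tr]; rewrite mulnC !divnMA; congr (_ %/ _)%N.
have -> : t.+1 = (t %/ rep_len p * rep_len p + (t %% rep_len p).+1)%N.
  by rewrite addnS -divn_eq.
by rewrite divnMDl ?rep_len_gt0// (divn_small tr) addn0.
Qed.

Lemma behaviour_rollout u z t : rollout_step t ->
  behaviour M p pi_e est u z t.+1 = phase_policy M p est u z (t %/ L).+1.
Proof.
move=> rt; have /andP[st tr] := rt; rewrite /behaviour (rollout_phase rt).
have -> : (t.+1 %% rep_len p = (t %% rep_len p).+1)%N.
  have -> : t.+1 = (t %/ rep_len p * rep_len p + (t %% rep_len p).+1)%N.
    by rewrite addnS -divn_eq.
  by rewrite modnMDl modn_small.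
by rewrite ltnNge leqW ?(ltnW st)//= gtn_eqF ?ltnS ?(ltnW st).
Qed.

(** Each repetition loses its [s'] exploration steps, the uniform action, and the final step, whose
    successor belongs to the next repetition. *)
Lemma count_non_rollout (t : nat) : (t <= total_len p)%N ->
  \sum_(i < t) (~~ rollout_step i)%:R <= (n_ p * m_ p * (s'_ p + 2))%:R :> R.
Proof.
move=> tN; apply: le_trans (ler_sum_ord_widen tN (fun i => ler0n R (~~ rollout_step i))) _.
rewrite /total_len mulnA (sum_ord_mul (fun i => (~~ rollout_step i)%:R)).
have -> (k : nat) : (k * (s'_ p + 2))%:R = \sum_(i < k) (s'_ p + 2)%:R :> R.
  by rewrite sumr_const card_ord -[RHS]mulr_natl natrM.
apply: ler_sum => i _.
rewrite -natr_sum ler_nat /rollout_step.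
under eq_bigr => j _ do rewrite modnMDl (modn_small (ltn_ord j)).
rewrite {1}/rep_len big_split_ord /= (_ : s'_ p + 2 = s'_ p + 1 + 1)%N; last by rewrite -addnA.
rewrite leq_add//.
  apply: (@leq_trans (\sum_(j < s'_ p + 1) 1)); last by rewrite sum1_card card_ord.
  by apply: leq_sum => j _; exact: leq_b1.
have E (j : 'I_(s_ p)) : ~~ ((s'_ p < rshift (s'_ p + 1) j)%N
    && ((rshift (s'_ p + 1) j).+1 < rep_len p)%N) = (j.+1 == s_ p).
  rewrite /= /rep_len -addnS ltn_add2l addn1 addSn ltnS leq_addr /= -leqNgt.
  by rewrite eqn_leq ltn_ord.
under eq_bigr do rewrite E.
case: (s_ p) => [|k]; first by rewrite big_ord0.
rewrite big_ord_recr /= eqxx big1// => j _.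
by rewrite eqSS ltn_eqF.
Qed.

End AlgorithmStructure.

Section AlgorithmMeasurability.
Variables (R : realType) (nS nA : nat) (M : mdp R nS nA) (p : params R)
  (pi_e : 'M[R]_(nS, nA)) (dU : measure_display) (U : measurableType dU)
  (est : estimator R nS nA U).
Hypothesis est_meas : estimator_measurable M p est.

Lemma measurable_phase_est z i : (i < n_ p)%N ->
  measurable_mx (fun u => phase_est M p est u z i.+1).
Proof. by move=> iN x a; apply: est_meas. Qed.

Lemma measurable_est_sum z k : (k <= n_ p)%N ->
  measurable_mx (fun u => est_sum M p est u z k).
Proof.
elim: k => [|k IH] kn; first exact: measurable_mx_cst.
by apply: measurable_mxD; [exact: IH (ltnW kn)|exact: measurable_phase_est].
Qed.

Lemma measurable_phase_policy z i : (i < n_ p)%N ->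
  measurable_mx (fun u => phase_policy M p est u z i.+1).
Proof. by move=> iN; apply: measurable_softmax; apply: measurable_est_sum; exact: ltnW. Qed.

Lemma phase_lt t : (t < total_len p)%N -> (t %/ (m_ p * rep_len p) < n_ p)%N.
Proof.
rewrite /total_len => tN; have L0 : (0 < m_ p * rep_len p)%N by case: (m_ p * rep_len p)%N tN => //; rewrite muln0.
by rewrite ltn_divLR.
Qed.

Lemma measurable_behaviour z t : (t < total_len p)%N ->
  measurable_mx (fun u => behaviour M p pi_e est u z t).
Proof.
move=> tN; rewrite /behaviour; case: (_ < _)%N; first exact: measurable_mx_cst.
case: (_ == _); first exact: measurable_mx_cst.
by apply: measurable_phase_policy; exact: phase_lt.
Qed.

End AlgorithmMeasurability.

(** * Pathwise regret bounds *)

Section PathwiseBounds.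
Variables (R : realType) (nS nA : nat) (M : mdp R nS nA) (kappa : R) (p : params R)
  (pi_e pi_star : 'M[R]_(nS, nA)) (U : Type) (est : estimator R nS nA U)
  (u : U) (z : trajectory nS nA).
Hypotheses (kappa_gt0 : 0 < kappa) (mixing : fast_mixing M kappa)
  (nA_gt0 : (0 < nA)%N) (pi_star_policy : is_policy pi_star).

Local Notation L := (m_ p * rep_len p)%N.
Local Notation B := (value_bound kappa).
Local Notation pol i := (phase_policy M p est u z i).

(** The function whose martingale differences are taken is zero off the rollout steps, so the
    differences vanish there. Such a step is charged [2 + 2 * B] instead: 2 for its cost gap and
    [2 * B] for the broken telescoping, which also covers every change of policy between phases. The
    isolated [2 + 2 * B] comes from the last step and from the ends of the telescoping sum. *)
Lemma rollout_cost_bound T : (0 < T <= total_len p)%N ->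
  \sum_(t < T) (cost M (z t).1 (z t).2 - avg_cost M (pol (t %/ L).+1))
  <= 2 + 2 * B + (2 + 2 * B) * (n_ p * m_ p * (s'_ p + 2))%:R
     + \sum_(t < T.-1) mart_diff M (behaviour M p pi_e est u)
         (fun z t => if rollout_step p t
                     then action_value M (phase_policy M p est u z (t %/ L).+1) else 0)
         z t.
Proof.
move=> /andP[T0 TN].
have pip i : is_policy (pol i) by exact: phase_policy_is_policy.
pose Q t := action_value M (pol (t %/ L).+1).
pose Phi t := Q t (z t).1 (z t).2.
pose D t := mart_diff M (behaviour M p pi_e est u)
  (fun z t => if rollout_step p t
              then action_value M (phase_policy M p est u z (t %/ L).+1) else 0) z t.
have B0 : 0 < B by exact: value_bound_gt0.
have PhiB t : `|Phi t| <= B by exact: action_value_le.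
have gap2 t : cost M (z t).1 (z t).2 - avg_cost M (pol (t %/ L).+1) <= 2.
  have := cost_bounded M (z t).1 (z t).2.
  have := avg_cost_le1 kappa_gt0 mixing (pip (t %/ L).+1).
  by rewrite !ler_norml => /andP[? ?] /andP[? ?]; lra.
have stepB t : cost M (z t).1 (z t).2 - avg_cost M (pol (t %/ L).+1)
    <= Phi t - Phi t.+1 + D t + (2 + 2 * B) * (~~ rollout_step p t)%:R.
  have [rt|nrt] := boolP (rollout_step p t).
    rewrite mulr0 addr0 /D /mart_diff rt behaviour_rollout//.
    rewrite {1}/Phi /Q (action_value_poisson kappa_gt0 mixing (z t).1 (z t).2 (pip _)).
    by rewrite /Phi /Q rollout_phase//; lra.
  have -> : D t = 0.
    rewrite /D /mart_diff (negbTE nrt) !mxE sub0r big1 ?oppr0// => x _.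
    by rewrite big1// => a _; rewrite mxE mulr0.
  have := gap2 t; have := PhiB t; have := PhiB t.+1.
  by rewrite !ler_norml => /andP[? ?] /andP[? ?] ?; rewrite mulr1; lra.
have tele N : \sum_(t < N) (cost M (z t).1 (z t).2 - avg_cost M (pol (t %/ L).+1))
    <= Phi 0%N - Phi N + \sum_(t < N) D t
       + (2 + 2 * B) * \sum_(t < N) (~~ rollout_step p t)%:R.
  elim: N => [|N IH]; first by rewrite !big_ord0; lra.
  by rewrite !big_ord_recr /= mulrDr; have := stepB N; lra.
have TN' : (T.-1 <= total_len p)%N by apply: leq_trans TN; exact: leq_pred.
have cnt : (2 + 2 * B) * \sum_(t < T.-1) (~~ rollout_step p t)%:R
    <= (2 + 2 * B) * (n_ p * m_ p * (s'_ p + 2))%:R.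
  by apply: ler_wpM2l; [lra|exact: count_non_rollout].
have splitT (F : nat -> R) : \sum_(t < T) F t = \sum_(t < T.-1) F t + F T.-1.
  by case: T T0 {TN TN' cnt} => // N _; rewrite big_ord_recr.
rewrite (splitT (fun t => cost M (z t).1 (z t).2 - avg_cost M (pol (t %/ L).+1))).
have := tele T.-1; have := gap2 T.-1; have := PhiB T.-1; have := PhiB 0%N.
rewrite !ler_norml => /andP[? ?] /andP[? ?] ? ?.
rewrite -/(\sum_(t < T.-1) D t); lra.
Qed.

Variables (b Qmax e : R).
Hypotheses (Qmax_gt0 : 0 < Qmax) (e_ge0 : 0 <= e)
  (eta_def : eta_ p = Num.sqrt (8 * ln nA%:R / (n_ p)%:R) / Qmax)
  (good : forall i, (i < n_ p)%N ->
     good_estimate M pi_star b Qmax e (pol i.+1) (phase_est M p est u z i.+1)).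

(** This is of order [Qmax * sqrt (n * ln nA)]. With [s] the square root and [eta = s / Qmax], the
    two terms of [exp_weights_regret] are at most [Qmax * n * s / 8] and [Qmax * n * s], and the
    factor 2 covers their sum. *)
Definition weights_bound : R := 2 * Qmax * ((n_ p)%:R * Num.sqrt (8 * ln nA%:R / (n_ p)%:R)).

Lemma weights_bound_ge0 : 0 <= weights_bound.
Proof. by rewrite /weights_bound !mulr_ge0 ?sqrtr_ge0// ltW. Qed.

(** With one action [ln nA%:R], and with it the learning rate, is zero, so exponential weights does
    not apply; but then all policies coincide and the sum vanishes. Otherwise the rate tuned for
    [n_ p] rounds is used for every [k <= n_ p]. *)
Lemma estimated_regret_le k x : (k <= n_ p)%N ->
  \sum_(i < k) \sum_a (pol i.+1 x a - pi_star x a) * phase_est M p est u z i.+1 x a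
  <= weights_bound.
Proof.
move=> kn; case: (ltngtP nA 1%N) => [|nA1|nA1].
- by rewrite ltnNge nA_gt0.
- have [->|k0] := posnP k; first by rewrite big_ord0 weights_bound_ge0.
  have n0 : 0 < (n_ p)%:R :> R by rewrite ltr0n (leq_trans k0).
  have lnA0 : 0 < ln nA%:R :> R by rewrite ln_gt0// ltr1n.
  pose s : R := Num.sqrt (8 * ln nA%:R / (n_ p)%:R).
  have s2 : s ^+ 2 = 8 * ln nA%:R / (n_ p)%:R.
    by rewrite sqr_sqrtr// divr_ge0 ?mulr_ge0// ltW.
  have s0 : 0 < s by rewrite sqrtr_gt0 divr_gt0// mulr_gt0.
  have eta0 : 0 < eta_ p by rewrite eta_def divr_gt0.
  have /= := @exp_weights_regret R nS nA (fun i => phase_est M p est u z i.+1) (eta_ p)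
    b Qmax k nA_gt0 eta0 _ pi_star x pi_star_policy.
  under eq_bigr => i _ do rewrite -est_sumE.
  have rng (i : nat) y a : (i < k)%N -> b <= phase_est M p est u z i.+1 y a <= b + Qmax.
    by move=> ik; have [_ _] := good (leq_trans ik kn).
  move=> /(_ rng) /le_trans; apply.
  rewrite eta_def -/s /weights_bound -/s.
  have -> : ln nA%:R = s ^+ 2 * (n_ p)%:R / 8.
    by rewrite s2; field; rewrite gt_eqF.
  have -> : s ^+ 2 * (n_ p)%:R / 8 / (s / Qmax) = Qmax * ((n_ p)%:R * s) / 8.
    by field; rewrite !gt_eqF.
  have -> : s / Qmax * k%:R * Qmax ^+ 2 = Qmax * (k%:R * s).
    by field; rewrite gt_eqF.
  have : Qmax * (k%:R * s) <= Qmax * ((n_ p)%:R * s).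
    by rewrite ler_pM2l// ler_pM2r// ler_nat.
  have : 0 <= Qmax * ((n_ p)%:R * s) by rewrite !mulr_ge0 ?ltW.
  by move=> ? ?; lra.
- rewrite big1 ?weights_bound_ge0// => i _; rewrite big1// => a _.
  have one (pi : 'M[R]_(nS, nA)) : is_policy pi -> pi x a = 1.
    move=> [_ /(_ x) <-]; rewrite (bigD1 a)//= big1 ?addr0// => c ca; exfalso.
    move/eqP: ca; apply; apply: val_inj.
    have v0 (o : 'I_nA) : val o = 0%N.
      by apply/eqP; rewrite -leqn0 -ltnS -nA1 ltn_ord.
    by rewrite !v0.
  rewrite (one (pol i.+1)) ?(one pi_star) ?subrr ?mul0r//.
  exact: phase_policy_is_policy.
Qed.

(** Both policies in the performance difference are weighted by the stationary distribution of
    [pi_star]. The estimation error is thus averaged over [otimes mu (pol i.+1)] and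
    [otimes mu pi_star], the two measures in [good_estimate], at a price of [e] each. *)
Lemma sum_avg_cost_phases (x0 : 'I_nS) k : (k <= n_ p)%N ->
  \sum_(i < k) (avg_cost M (pol i.+1) - avg_cost M pi_star)
  <= k%:R * (2 * e) + weights_bound.
Proof.
move=> kn; have pip i : is_policy (pol i) by exact: phase_policy_is_policy.
have [[mu0 mu1] _] := stat_distP kappa_gt0 mixing x0 pi_star_policy.
set mu := stat_dist M pi_star in mu0 mu1.
pose E i : 'M[R]_(nS, nA) := action_value M (pol i.+1) - phase_est M p est u z i.+1.
pose reg i := \sum_x mu 0 x * \sum_a (pol i.+1 x a - pi_star x a)
                * phase_est M p est u z i.+1 x a.
have wmean (pi f : 'M[R]_(nS, nA)) : is_policy pi ->
    `|\sum_x \sum_a otimes mu pi x a * f x a| <= wnorm (otimes mu pi) f.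
  move=> [pi0 pi1]; apply: mean_le_wnorm => [x a|]; first by rewrite mxE mulr_ge0.
  rewrite -mu1; apply: eq_bigr => x _; under eq_bigr do rewrite mxE.
  by rewrite -mulr_sumr pi1 mulr1.
have phase i : (i < k)%N ->
    avg_cost M (pol i.+1) - avg_cost M pi_star <= 2 * e + reg i.
  move=> ik; have [g1 g2 _] := good (leq_trans ik kn).
  rewrite (performance_difference kappa_gt0 mixing x0)// -/mu.
  have -> : \sum_x mu 0 x * \sum_a (pol i.+1 x a - pi_star x a)
        * action_value M (pol i.+1) x a
      = \sum_x \sum_a otimes mu (pol i.+1) x a * E i x a
        - \sum_x \sum_a otimes mu pi_star x a * E i x a + reg i.
    rewrite -sumrB -big_split; apply: eq_bigr => x _ /=.
    rewrite -sumrB !mulr_sumr -big_split; apply: eq_bigr => a _ /=.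
    by rewrite !mxE; ring.
  have := le_trans (wmean _ (E i) (pip i.+1)) g2.
  have := le_trans (wmean _ (E i) pi_star_policy) g1.
  by rewrite !ler_norml => /andP[? ?] /andP[? ?]; lra.
apply: (@le_trans _ _ (\sum_(i < k) (2 * e + reg i))).
  by apply: ler_sum => i _; exact: phase.
rewrite big_split /= sumr_const card_ord -[X in X + _]mulr_natl lerD2l.
rewrite exchange_big /=.
rewrite -[leRHS]mul1r -mu1 mulr_suml; apply: ler_sum => x _.
by rewrite -mulr_sumr ler_wpM2l// estimated_regret_le.
Qed.

(** The horizon may stop inside a phase. Complete phases are summed as blocks of length [L], and the
    incomplete one costs at most 2 per step. *)
Lemma sum_avg_cost_le (x0 : 'I_nS) T : (T <= total_len p)%N -> (0 < L)%N ->
  \sum_(t < T) (avg_cost M (pol (t %/ L).+1) - avg_cost M pi_star)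
  <= 2 * e * T%:R + L%:R * (weights_bound + 2).
Proof.
move=> TN L0.
have pip i : is_policy (pol i) by exact: phase_policy_is_policy.
pose h t := avg_cost M (pol (t %/ L).+1) - avg_cost M pi_star.
have kn : (T %/ L <= n_ p)%N.
  by rewrite -(mulnK (n_ p) L0); apply: leq_div2r.
have h2 t : h t <= 2.
  have := avg_cost_le1 kappa_gt0 mixing (pip (t %/ L).+1).
  have := avg_cost_le1 kappa_gt0 mixing pi_star_policy.
  by rewrite !ler_norml /h => /andP[? ?] /andP[? ?]; lra.
have split_sum n n1 n2 : n = (n1 + n2)%N ->
    \sum_(t < n) h t = \sum_(t < n1) h t + \sum_(t < n2) h (n1 + t)%N.
  by move=> ->; rewrite big_split_ord.
rewrite (split_sum _ _ _ (divn_eq T L)).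
have head : \sum_(t < T %/ L * L) h t
    <= L%:R * ((T %/ L)%:R * (2 * e) + weights_bound).
  rewrite sum_ord_mul.
  apply: le_trans (ler_wpM2l (ler0n R L) (sum_avg_cost_phases x0 kn)).
  rewrite mulr_sumr; apply: ler_sum => i _.
  have hi (j : 'I_L) : h (i * L + j)%N = avg_cost M (pol i.+1) - avg_cost M pi_star.
    by rewrite /h divnMDl// (divn_small (ltn_ord j)) addn0.
  by under eq_bigr do rewrite hi; rewrite sumr_const card_ord -[X in X <= _]mulr_natl.
have tail : \sum_(t < T %% L) h (T %/ L * L + t)%N <= L%:R * 2.
  apply: (@le_trans _ _ (\sum_(t < T %% L) 2)); first by apply: ler_sum.
  rewrite sumr_const card_ord -[X in X <= _]mulr_natl ler_wpM2r// ler_nat.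
  by rewrite ltnW// ltn_mod.
have : (L * (T %/ L))%:R * (2 * e) <= T%:R * (2 * e).
  by rewrite ler_wpM2r ?mulr_ge0// ler_nat mulnC leq_divM.
rewrite natrM; lra.
Qed.

End PathwiseBounds.

(** * Measurable coordinates, a union bound and elementary inequalities *)

Lemma measurable_process_coord (R : realType) (nS nA : nat) (d : measure_display)
    (Om : measurableType d) (tau : Om -> trajectory nS nA) (N t : nat)
    (g : 'I_nS * 'I_nA -> R) :
  process_measurable tau N -> (t < N)%N ->
  measurable_fun [set: Om] (fun w => g (tau w t)).
Proof.
move=> mtau tN.
rewrite (_ : (fun w => _) = fun w => \sum_y g y * \1_[set w | tau w t = y] w).
  apply: measurable_sum => y; apply: measurable_funM; first exact: measurable_cst.
  by apply: measurable_indic; exact: mtau.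
apply/funext => w; rewrite (bigD1 (tau w t))//= big1 ?addr0 => [|y yt].
  by rewrite indicE mem_set// mulr1.
by rewrite indicE memNset ?mulr0// => /= wy; rewrite wy eqxx in yt.
Qed.

Lemma prob_bigsetU_le (R : realType) (d : measure_display) (Om : measurableType d)
    (Pr : probability Om R) (A : nat -> set Om) (c : R) n :
  (forall i, (i < n)%N -> measurable (A i) /\ (Pr (A i) <= c%:E)%E) ->
  measurable (\big[setU/set0]_(i < n) A i) /\
  (Pr (\big[setU/set0]_(i < n) A i) <= (n%:R * c)%:E)%E.
Proof.
elim: n => [|n IH] mA; first by rewrite big_ord0 measure0 mul0r.
have [mU PU] := IH (fun i iN => mA i (ltnW iN)); have [mn Pn] := mA n (ltnSn n).
rewrite big_ord_recr /=; split; first exact: measurableU.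
apply: (le_trans (measureU2 _ mU mn)).
by rewrite -natr1 mulrDl mul1r EFinD; apply: leeD.
Qed.

Lemma ceiln_itv (R : realType) (x : R) : 0 <= x -> x <= (ceiln x)%:R <= x + 1.
Proof.
move=> x0; have c0 : 0 <= Num.ceil x by rewrite ceil_ge0; lra.
rewrite /ceiln natr_absz ger0_norm//; apply/andP; split; first exact: ceil_ge.
by have /andP[+ _] := ceil_itv x; rewrite intrB; lra.
Qed.

Lemma sqrtr_div_le (R : rcfType) (a N X : R) : 0 <= a -> 0 < X -> X ^+ 2 <= N ->
  Num.sqrt (a / N) <= Num.sqrt a / X.
Proof.
move=> a0 X0 XN; have X20 : 0 < X ^+ 2 by rewrite exprn_gt0.
have -> : Num.sqrt a / X = Num.sqrt (a / X ^+ 2).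
  by rewrite sqrtrM// sqrtrV ?sqr_ge0// sqrtr_sqr gtr0_norm.
by rewrite ler_wsqrtr// ler_wpM2l// lef_pV2 ?posrE//; exact: lt_le_trans XN.
Qed.

Lemma sqrtr_le_1Dx (R : rcfType) (y : R) : 0 <= y -> Num.sqrt y <= 1 + y.
Proof.
move=> y0; have -> : 1 + y = Num.sqrt ((1 + y) ^+ 2) by rewrite sqrtr_sqr ger0_norm ?addr_ge0.
by apply: ler_wsqrtr; have := sqr_ge0 y; nra.
Qed.

Lemma ln_le_subr1 (R : realType) (x : R) : 0 < x -> ln x <= x - 1.
Proof.
move=> x0; rewrite -{1}(subrK 1 x) addrC; apply: le_ln1Dx; lra.
Qed.

(** * Horizon-dependent parameters *)

Section ParameterBounds.
Variables (R : realType) (nA T : nat) (Qmax : R).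
Hypothesis T_gt0 : (0 < T)%N.

Local Notation p := (eepolitex_params nA T Qmax).
Local Notation X := (T%:R `^ (1 / 5) : R).

Let T1 : 1 <= T%:R :> R. Proof. by rewrite ler1n. Qed.

Let powX k : T%:R `^ (k%:R / 5) = X ^+ k.
Proof. by rewrite -powR_mulrn ?powR_ge0// -powRrM; congr (_ `^ _); lra. Qed.

Lemma root_ge1 : 1 <= X.
Proof. by rewrite -[leLHS](powRr0 T%:R) ler_powR//; lra. Qed.

Lemma horizon_rootE : T%:R = X ^+ 5.
Proof. by rewrite -powX divff ?powRr1 ?ler0n// pnatr_eq0. Qed.

Lemma regret_rate_rootE : T%:R `^ (4 / 5) = X ^+ 4.
Proof. exact: powX. Qed.

Lemma num_phases_bounds : X ^+ 2 <= (n_ p)%:R <= 2 * X ^+ 2.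
Proof.
have /andP[lo hi] := ceiln_itv (powR_ge0 (T%:R : R) (2 / 5)).
rewrite -powX lo /=; apply: (le_trans hi).
suff : 1 <= T%:R `^ (2 / 5) :> R by lra.
by rewrite powX; apply: exprn_ege1; exact: root_ge1.
Qed.

Lemma exploration_len_le : (s'_ p)%:R <= 1 + ln T%:R :> R.
Proof. by have /andP[_] := ceiln_itv (ln_ge0 T1); rewrite addrC. Qed.

Lemma rep_len_bounds : X <= (rep_len p)%:R <= 4 * (1 + ln T%:R) * X.
Proof.
have /andP[lo hi] := ceiln_itv (powR_ge0 (T%:R : R) (1 / 5)).
have lnT := ln_ge0 T1; have X1 := root_ge1; have s'le := exploration_len_le.
rewrite /rep_len /= in s'le *; apply/andP; split.
  (* With truncated subtraction [c + (a - c)] is a maximum, so the lower bound survives when [log T]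
     exceeds [T^(1/5)]. *)
  apply: (le_trans lo); rewrite ler_nat; set a := ceiln _; set c := ceiln _.
  by rewrite addn1 addSn leqW// -maxnE leq_maxr.
apply: (@le_trans _ _ ((s'_ p)%:R + 1 + (ceiln (T%:R `^ (1 / 5) : R))%:R)).
  by rewrite !natrD lerD2l ler_nat leq_subr.
rewrite /=; set s' := (X in X%:R + _ + _) in s'le *; nra.
Qed.

Lemma horizon_le_total_len : (T <= total_len p)%N.
Proof.
rewrite -(ler_nat R) /total_len !natrM horizon_rootE.
have X0 : 0 <= X by exact: powR_ge0.
have /andP[nX _] := num_phases_bounds; have /andP[rX _] := rep_len_bounds.
have -> : X ^+ 5 = X ^+ 2 * (X ^+ 2 * X) by ring.
by apply: ler_pM; rewrite ?mulr_ge0 ?exprn_ge0//; apply: ler_pM; rewrite ?exprn_ge0.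
Qed.

End ParameterBounds.

(* With [X = T^(1/5)], every term of the regret decomposition is
   [O (X ^+ 4 * l + eps0 * T)]. *)
Lemma regret_terms_le (R : realType) (nA T : nat) (Qmax B C eps0 delta : R) :
  let p := eepolitex_params nA T Qmax in
  let e := eps0 + C * Num.sqrt (ln (1 / (delta / (3 * (n_ p)%:R))) / (m_ p)%:R) in
  let l := 1 + ln T%:R + ln (1 / delta) in
  (0 < T)%N -> (0 < nA)%N -> 0 < Qmax -> 0 < B -> 0 < C -> 0 <= eps0 -> 0 < delta < 1 ->
  (2 + 2 * B + (2 + 2 * B) * (n_ p * m_ p * (s'_ p + 2))%:R
    + 6 * B * Num.sqrt T%:R * (1 + ln (1 / (delta / 3))))
  + (2 * e * T%:R + (m_ p * rep_len p)%:R * (weights_bound nA p Qmax + 2))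
  + (2 * B + 2 + 6 * B * Num.sqrt T%:R * (1 + ln (1 / (delta / 3))))
  <= (44 + 76 * B + 12 * C + 32 * Qmax * Num.sqrt (8 * ln nA%:R)) * l ^+ 1
     * (T%:R `^ (4 / 5) + eps0 * T%:R).
Proof.
move=> p e l T0 nA0 Qmax0 B0 C0 eps00 /andP[d0 d1].
rewrite regret_rate_rootE expr1.
have X1 := root_ge1 R T0; have TX := horizon_rootE R T.
have /andP[nlo nhi] := num_phases_bounds nA Qmax T0.
have /andP[rlo rhi] := rep_len_bounds nA Qmax T0.
have s'hi := exploration_len_le nA Qmax T0.
rewrite -/p in nlo nhi rlo rhi s'hi.
have mn : m_ p = n_ p by [].
rewrite mn in e *.
set X := T%:R `^ (1 / 5) in X1 TX nlo nhi rlo rhi *.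
set a := Num.sqrt (8 * ln nA%:R).
have X0 : 0 < X by lra.
have T1 : 1 <= T%:R :> R by rewrite ler1n.
have lnT : 0 <= ln T%:R :> R by exact: ln_ge0.
have lnd : 0 <= ln (1 / delta) by rewrite ln_ge0// ler_pdivlMr// mul1r ltW.
have l1 : 1 <= l by rewrite /l; lra.
set N : R := (n_ p)%:R in nlo nhi e *.
set r : R := (rep_len p)%:R in rlo rhi *.
have N0 : 0 < N by apply: lt_le_trans nlo; rewrite exprn_gt0.
have X4 : 1 <= X ^+ 4 by rewrite exprn_ege1.
have X40 : 0 <= X ^+ 4 by lra.
pose Z := X ^+ 4 * l.
have Z1 : 1 <= Z by rewrite /Z -[leLHS]mulr1 ler_pM.
have ZX : X ^+ 4 <= Z by rewrite /Z ler_peMr.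
have lX3 : l * X ^+ 3 <= Z.
  rewrite /Z [leRHS]mulrC; apply: ler_wpM2l; first lra.
  by rewrite [leRHS]exprS ler_peMl ?exprn_ge0 ?(ltW X0).
have a0 : 0 <= a by exact: sqrtr_ge0.
have cnt : (n_ p * n_ p * (s'_ p + 2))%:R <= 12 * Z.
  rewrite !natrM natrD -/N.
  have -> : 12 * Z = (2 * X ^+ 2) * (2 * X ^+ 2) * (3 * l) by rewrite /Z; ring.
  apply: ler_pM; rewrite ?mulr_ge0 ?addr_ge0 ?ler0n ?(ltW N0)//.
    by apply: ler_pM; rewrite ?(ltW N0).
  by rewrite /l; lra.
have sqrtT : Num.sqrt T%:R <= X ^+ 4.
  have -> : X ^+ 4 = Num.sqrt ((X ^+ 4) ^+ 2) by rewrite sqrtr_sqr ger0_norm.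
  by rewrite ler_wsqrtr// TX -exprM ler_weXn2l.
have log3 : 0 <= 1 + ln (1 / (delta / 3)) <= 4 * l.
  have -> : 1 / (delta / 3) = 3 * (1 / delta) by field; rewrite gt_eqF.
  rewrite lnM ?posrE ?divr_gt0//.
  have := ln_le_subr1 (ltr0n R 3); have : 0 <= ln 3 :> R by rewrite ln_ge0// ler1n.
  by rewrite /l; lra.
have conc : 6 * B * Num.sqrt T%:R * (1 + ln (1 / (delta / 3))) <= 24 * (B * Z).
  have -> : 24 * (B * Z) = 6 * B * X ^+ 4 * (4 * l) by rewrite /Z; ring.
  have /andP[lg0 lg4] := log3.
  apply: ler_pM => //; first by rewrite !mulr_ge0 ?sqrtr_ge0// ltW.
  by rewrite ler_wpM2l// mulr_ge0// ltW.
have est_err : 2 * e * T%:R <= 2 * (eps0 * T%:R) + 12 * (C * Z).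
  rewrite /e; set y := ln (1 / (delta / (3 * N))).
  have yE : y = ln (3 * N) + ln (1 / delta).
    rewrite /y -lnM ?posrE ?divr_gt0 ?mulr_gt0//; congr ln.
    by field; rewrite !gt_eqF.
  have N1 : 1 <= N by apply: le_trans nlo; rewrite exprn_ege1.
  have y0 : 0 <= y by rewrite yE addr_ge0// ln_ge0//; lra.
  have NT : 3 * N <= 6 * T%:R.
    have : X ^+ 2 <= T%:R by rewrite TX ler_weXn2l.
    lra.
  have yl : y <= 4 + l.
    rewrite yE; apply: (@le_trans _ _ (ln (6 * T%:R) + ln (1 / delta))).
      by rewrite lerD2r ler_ln ?posrE//; [lra|rewrite mulr_gt0//; lra].
    rewrite lnM ?posrE//; last lra.
    by have := ln_le_subr1 (ltr0n R 6); rewrite /l; lra.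
  (* The square root of the logarithm is bounded crudely by [1 + y <= 5 + l <= 6 * l]. This stays
     within a single factor [l], as in the other terms. *)
  have sy : Num.sqrt (y / N) <= 6 * l / X.
    apply: (le_trans (sqrtr_div_le y0 X0 nlo)).
    rewrite ler_pM2r ?invr_gt0//; apply: (le_trans (sqrtr_le_1Dx y0)); lra.
  have -> : 2 * (eps0 + C * Num.sqrt (y / N)) * T%:R
     = 2 * (eps0 * T%:R) + 2 * C * (Num.sqrt (y / N) * T%:R) by ring.
  have -> : 12 * (C * Z) = 2 * C * (6 * l / X * T%:R).
    by rewrite TX /Z; field; rewrite gt_eqF.
  rewrite lerD2l ler_wpM2l ?mulr_ge0 ?(ltW C0)//.
  by rewrite ler_wpM2r// ler0n.
have W_le : weights_bound nA p Qmax <= 4 * Qmax * (X * a).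
  have -> : 4 * Qmax * (X * a) = 2 * Qmax * (2 * X ^+ 2 * (a / X)).
    by field; rewrite gt_eqF.
  rewrite /weights_bound -/N ler_wpM2l ?mulr_ge0 ?(ltW Qmax0)//.
  apply: ler_pM; rewrite ?sqrtr_ge0 ?(ltW N0)//.
  by apply: sqrtr_div_le => //; rewrite mulr_ge0// ln_ge0// ler1n.
have L_le : (n_ p * rep_len p)%:R <= 8 * (l * X ^+ 3).
  rewrite natrM -/N -/r.
  have -> : 8 * (l * X ^+ 3) = 2 * X ^+ 2 * (4 * l * X) by ring.
  apply: ler_pM; rewrite ?ler0n ?(ltW N0)//; apply: (le_trans rhi).
  by rewrite ler_wpM2r ?(ltW X0)// /l; lra.
have LW : (n_ p * rep_len p)%:R * (weights_bound nA p Qmax + 2)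
    <= 32 * Qmax * a * Z + 16 * Z.
  have W0 := weights_bound_ge0 nA p Qmax0.
  apply: (@le_trans _ _ (8 * (l * X ^+ 3) * (4 * Qmax * (X * a) + 2))).
    by apply: ler_pM; rewrite ?ler0n ?addr_ge0// lerD2r.
  have -> : 8 * (l * X ^+ 3) * (4 * Qmax * (X * a) + 2)
     = 32 * Qmax * a * Z + 16 * (l * X ^+ 3) by rewrite /Z; ring.
  by rewrite lerD2l ler_wpM2l.
have expl : (2 + 2 * B) * (n_ p * n_ p * (s'_ p + 2))%:R <= (2 + 2 * B) * (12 * Z).
  by rewrite ler_wpM2l// addr_ge0// mulr_ge0// ltW.
have BZ : B <= B * Z by rewrite ler_peMr// ltW.
(* Constants are absorbed by [1 <= Z]. The coefficient 44 is [2 + 24 + 16 + 2], from the boundary of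
   the run, exploration, the phase length and the boundary of the baseline; 76 is [2 + 24 + 24] from
   the run plus [2 + 24] from the baseline. *)
set K := 44 + 76 * B + 12 * C + 32 * Qmax * a.
have K2 : 2 <= K.
  have : 0 <= Qmax * a by rewrite mulr_ge0// ltW.
  by rewrite /K; lra.
have eT0 : 0 <= eps0 * T%:R by rewrite mulr_ge0.
have Kl2 : 2 <= K * l by rewrite -[leLHS]mulr1 ler_pM.
have epsK : 2 * (eps0 * T%:R) <= K * l * (eps0 * T%:R) by rewrite ler_wpM2r.
have -> : K * l * (X ^+ 4 + eps0 * T%:R) = K * Z + K * l * (eps0 * T%:R).
  by rewrite /Z; ring.
have -> : K * Z = 44 * Z + 76 * (B * Z) + 12 * (C * Z) + 32 * Qmax * a * Z.
  by rewrite /K; ring.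
have := expl; rewrite (_ : (2 + 2 * B) * (12 * Z) = 24 * Z + 24 * (B * Z)); last by ring.
lra.
Qed.

(** * Combining the bounds outside one exceptional event *)

Theorem mainTheorem1 (R : realType) (nS nA : nat) (M : mdp R nS nA)
    (pi_star : 'M[R]_(nS, nA)) (kappa C Qmax : R) :
  unichain M ->
  0 < kappa -> fast_mixing M kappa ->
  is_policy pi_star ->
  0 < C -> 0 < Qmax ->
  exists (K : R) (q : nat), 0 < K /\
  forall (T : nat) (x0 : 'I_nS) (pi_e : 'M[R]_(nS, nA)) (eps0 b : R)
    (dU : measure_display) (U : measurableType dU) (est : estimator R nS nA U)
    (d : measure_display) (Om : measurableType d) (Pr : probability Om R)
    (xi : Om -> U) (tau tau_star : Om -> trajectory nS nA),
  let p := eepolitex_params nA T Qmax in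
  (0 < T)%N ->
  is_policy pi_e ->
  0 <= eps0 ->
  estimator_measurable M p est ->
  is_eepolitex_run M p x0 pi_e est Pr xi tau ->
  is_policy_run M x0 pi_star T Pr tau_star ->
  (forall (delta : R) (i : nat), 0 < delta < 1 -> (1 <= i <= n_ p)%N ->
     ((1 - delta)%:E <=
      Pr [set w | good_estimate M pi_star b Qmax
                    (eps0 + C * Num.sqrt (ln (1 / delta) / (m_ p)%:R))
                    (phase_policy M p est (xi w) (tau w) i)
                    (phase_est M p est (xi w) (tau w) i)])%E) ->
  forall delta : R, 0 < delta < 1 ->
    ((1 - delta)%:E <=
     Pr [set w | (regret M T (tau w) (tau_star w)
                 <= K * (1 + ln T%:R + ln (1 / delta)) ^+ q
                      * (T%:R `^ (4 / 5) + eps0 * T%:R))%R])%E.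
Proof.
move=> _ kappa0 mixing pi_starp C0 Qmax0.
exists (44 + 76 * value_bound kappa + 12 * C + 32 * Qmax * Num.sqrt (8 * ln nA%:R)), 1%N.
have B0 : 0 < value_bound kappa by exact: value_bound_gt0.
split.
  have : 0 <= Qmax * Num.sqrt (8 * ln nA%:R) by rewrite mulr_ge0 ?sqrtr_ge0// ltW.
  by lra.
move=> T x0 pi_e eps0 b dU U est d Om Pr xi tau tau_star p T0 pi_ep eps00 est_meas
  [xi_meas tau_meas law] run_star est_good delta delta01.
have nA0 : (0 < nA)%N.
  rewrite lt0n; apply/eqP => nA0; have := proj2 pi_starp x0.
  rewrite big1 => [/eqP|[k kn] _]; first by rewrite eq_sym oner_eq0.
  by exfalso; rewrite nA0 in kn.
have /andP[d0 d1] := delta01.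
have TN : (T <= total_len p)%N by exact: horizon_le_total_len.
have N0 : (0 < total_len p)%N by exact: leq_trans TN.
have n0 : (0 < n_ p)%N by move: N0; rewrite /total_len; case: (n_ p).
have L0 : (0 < m_ p * rep_len p)%N by move: N0; rewrite /total_len muln_gt0 => /andP[].
pose z0 : trajectory nS nA := fun=> (x0, Ordinal nA0).
pose f u z t := if rollout_step p t
  then action_value M (phase_policy M p est u z (t %/ (m_ p * rep_len p)).+1)
  else (0 : 'M[R]_(nS, nA)).
have f_le u z t x a : `|f u z t x a| <= value_bound kappa.
  rewrite /f; case: ifP => _; last by rewrite mxE normr0 ltW.
  by apply: action_value_le => //; exact: phase_policy_is_policy.
have f_adapted u z z' t : agree t.+1 z z' -> f u z t = f u z' t.
  move=> zz; rewrite /f (@phase_policy_adapted _ _ _ _ _ _ _ u z z')// => r rt.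
  by apply: zz; apply: leq_trans rt _; rewrite leqW// leq_divM.
have f_meas z t : (t.+1 < total_len p)%N -> measurable_mx (fun u => f u z t).
  move=> tN; rewrite /f; case: (rollout_step p t); last exact: measurable_mx_cst.
  apply: (measurable_action_value kappa0 mixing) => [u|]; first exact: phase_policy_is_policy.
  by apply: measurable_phase_policy => //; apply: phase_lt; exact: ltnW.
have d30 : 0 < delta / 3 by rewrite divr_gt0.
have [A1 [mA1 PA1 A1_le]] := @azuma R nS nA M x0 z0 _ U _ Om Pr xi tau (total_len p)
  xi_meas tau_meas (fun u z t => behaviour M p pi_e est u z t) N0
  (fun u z t => behaviour_is_policy M p est nA0 pi_ep u z t)
  (fun u z z' t => @behaviour_adapted R nS nA M p pi_e U est u z z' t)
  (fun z t => measurable_behaviour pi_e est_meas z (t := t)) law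
  f (value_bound kappa) B0 f_le f_adapted f_meas T (delta / 3)
  (introT andP (conj T0 TN)) d30.
have [A2 [mA2 PA2 A2_le]] := policy_run_lower_bound kappa0 mixing pi_starp nA0 T0 run_star d30.
(* The third of [delta] left after the two martingale bounds is shared equally by the [n_ p] phases;
   in the tolerance [e] this costs only a logarithm. *)
pose delta_n := delta / (3 * (n_ p)%:R).
have n1 : 1 <= (n_ p)%:R :> R by rewrite ler1n.
have dn01 : 0 < delta_n < 1.
  apply/andP; split; first by rewrite divr_gt0// mulr_gt0//; lra.
  by rewrite ltr_pdivrMr; lra.
pose e := eps0 + C * Num.sqrt (ln (1 / delta_n) / (m_ p)%:R).
have e0 : 0 <= e by rewrite addr_ge0// mulr_ge0 ?sqrtr_ge0// ltW.
pose good_phase i := [set w | good_estimate M pi_star b Qmax e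
  (phase_policy M p est (xi w) (tau w) i.+1) (phase_est M p est (xi w) (tau w) i.+1)].
have phase_ok i : (i < n_ p)%N ->
    measurable (~` good_phase i) /\ (Pr (~` good_phase i) <= delta_n%:E)%E.
  (* Passing to the probability of the complement requires a measurable event; this one depends on
     the seed and on the coordinates up to the end of the phase. *)
  move=> iN; have mgood : measurable (good_phase i).
    apply: (measurable_process_set z0 xi_meas tau_meas (Q := fun u z =>
      good_estimate M pi_star b Qmax e (phase_policy M p est u z i.+1)
        (phase_est M p est u z i.+1))) => [z|u z z' zz].
      apply: (measurable_good_estimate kappa0 mixing) => [u|x a|x a].
      - exact: phase_policy_is_policy.
      - exact: measurable_phase_policy.
      - exact: measurable_phase_est.
    have zi : agree (i.+1 * (m_ p * rep_len p)) z z'.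
      by move=> t ti; apply: zz; apply: leq_trans ti _; rewrite leq_mul2r iN orbT.
    have zi' : agree (i * (m_ p * rep_len p)) z z'.
      by move=> t ti; apply: zi; apply: leq_trans ti _; rewrite mulSn leq_addl.
    by rewrite (phase_est_adapted M est u zi) (phase_policy_adapted M est u zi').
  split; first exact: measurableC.
  rewrite probability_setC//.
  have : ((1 - delta_n)%:E <= Pr (good_phase i))%E by apply: est_good.
  rewrite -(fineK (fin_num_measure Pr _ mgood)) lee_fin => Pg.
  by rewrite -EFinB lee_fin; lra.
have [mA3 PA3] := prob_bigsetU_le phase_ok.
set A3 := \big[setU/set0]_(i < n_ p) _ in mA3 PA3.
set target := [set w | _].
have mtarget : measurable target.
  rewrite /target -[X in measurable X]setTI; apply: measurable_fun_le => //.
  apply: measurable_funB; apply: measurable_sum => t.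
    apply: (measurable_process_coord (fun y => cost M y.1 y.2) tau_meas).
    exact: leq_trans (ltn_ord t) TN.
  exact: (measurable_process_coord (fun y => cost M y.1 y.2) (proj1 run_star)).
have mbad : measurable (A1 `|` A2 `|` A3) by apply: measurableU => //; exact: measurableU.
have Pbad : (Pr (A1 `|` A2 `|` A3) <= delta%:E)%E.
  apply: (le_trans (measureU2 _ (measurableU _ _ mA1 mA2) mA3)).
  have -> : delta%:E = ((delta / 3)%:E + (delta / 3)%:E + (delta / 3)%:E)%E.
    by rewrite -!EFinD; congr EFin; field.
  apply: leeD; last first.
    apply: (le_trans PA3); rewrite lee_fin le_eqVlt; apply/orP; left; apply/eqP.
    by rewrite /delta_n; field; rewrite gt_eqF//; lra.
  by apply: (le_trans (measureU2 _ mA1 mA2)); exact: leeD.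
have Pgood : ((1 - delta)%:E <= Pr (~` (A1 `|` A2 `|` A3)))%E.
  rewrite probability_setC//; move: Pbad.
  rewrite -(fineK (fin_num_measure Pr _ mbad)) lee_fin => Pb.
  by rewrite -EFinB lee_fin; lra.
apply: (le_trans Pgood); apply: le_measure; rewrite ?inE//; first exact: measurableC.
move=> w nbad; have [nA1 [nA2 nA3]] : ~ A1 w /\ ~ A2 w /\ ~ A3 w.
  by split; [|split] => Aw; apply: nbad; [left; left|left; right|right].
have good i : (i < n_ p)%N -> good_phase i w.
  move=> iN; apply: contrapT => ngood; apply: nA3.
  have -> : A3 = \bigcup_(k in `I_(n_ p)) ~` good_phase k by rewrite bigcup_mkord.
  by exists i.
have b1 := rollout_cost_bound pi_e est (xi w) (tau w) kappa0 mixing nA0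
  (introT andP (conj T0 TN)).
have eta_def : eta_ p = Num.sqrt (8 * ln nA%:R / (n_ p)%:R) / Qmax by [].
have b2 := sum_avg_cost_le kappa0 mixing nA0 pi_starp Qmax0 e0 eta_def good x0 TN L0.
have b3 := A2_le w nA2.
have b4 := A1_le w nA1.
rewrite /target /=.
apply: le_trans (regret_terms_le T0 nA0 Qmax0 B0 C0 eps00 delta01).
have -> : regret M T (tau w) (tau_star w)
  = \sum_(t < T) (cost M (tau w t).1 (tau w t).2
      - avg_cost M (phase_policy M p est (xi w) (tau w) (t %/ (m_ p * rep_len p)).+1))
    + \sum_(t < T) (avg_cost M (phase_policy M p est (xi w) (tau w)
                       (t %/ (m_ p * rep_len p)).+1) - avg_cost M pi_star)
    + \sum_(t < T) (avg_cost M pi_star - cost M (tau_star w t).1 (tau_star w t).2).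
  rewrite /regret -sumrB -!big_split; apply: eq_bigr => t _ /=; ring.
apply: lerD; last exact: b3.
apply: lerD; last exact: b2.
by apply: (le_trans b1); rewrite lerD2l; exact: b4.
Qed.
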